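(* Assume (A1), (A2'), and $\alpha\ge\frac12\max\{0,\max_{j\in\Gamma_h}(V(x_j)+\omega)\}+\frac12$. For fixed $h$, let $u_h^*$ be a discrete ground state satisfying the discrete non-degeneracy condition (NDh). Then there exists $\delta_0>0$ such that for every initial datum $u_h^0\in U_{h,\delta_0}(u_h^* )\cap\mathcal S_{h,p+1}$ and every $\tau>0$, the fully discrete GFALM iterates satisfy $$\|u_h^n-u_h^*\|_{1,h}\le Ce^{-an\tau/(1+\tau)}\qquad\forall n\in\mathbb N,$$ with constants $C,a>0$ independent of $n$ and $\tau$.
   Context: Fully discrete setting ($d=1$), real-valued grid functions. $\Omega=[x_0,x_0+L]$, $M>0$ even, $h=L/M$, grid $x_j=x_0+jh$, $j\in\Gamma_h=\{0,\dots,M-1\}$, periodic; $X_h=\mathbb R^M$. $\varphi_j(x)=\frac1M\sum_{l=-M/2}^{M/2}\frac1{a_l}e^{\mathrm il\sigma(x-x_j)}$, $a_l=1$ ($|l|<M/2$), $a_l=2$ ($|l|=M/2$), $\sigma=2\pi/L$; $(\mathbf D_{xx})_{j,l}=\varphi_l''(x_j)$. $\langle u_h,v_h\rangle_h=h\sum_ju_jv_j$, $\|u_h\|_h^2=\langle u_h,u_h\rangle_h$, $|u_h|_{1,h}^2=\langle-\mathbf D_{xx}u_h,u_h\rangle_h$, $\|u_h\|_{1,h}^2=\|u_h\|_h^2+|u_h|_{1,h}^2$, $\|u_h\|_{h,q}=(h\sum_j|u_j|^q)^{1/q}$. $V_j=V(x_j)$; $Q_h(u_h)=\frac12|u_h|_{1,h}^2+h\sum_jV_j|u_j|^2+\omega\|u_h\|_h^2$;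 $(\mathcal A_hu_h)_j=-\frac12(\mathbf D_{xx}u_h)_j+(V_j+\omega)u_j$. $\mathcal S_{h,p+1}=\{u_h:\|u_h\|_{h,p+1}=1\}$; $\widetilde\lambda_h(u_h)=Q_h(u_h)/\|u_h\|_{h,p+1}^{p+1}$. (A1): $1<p<\infty$, $V\ge0$ bounded. $\lambda_0':=\inf\{\frac12|u_h|_{1,h}^2+h\sum_jV_j|u_j|^2:\|u_h\|_h=1\}$; (A2'): $\omega>-\lambda_0'$. A discrete ground state is $u_h^*\in\arg\min\{Q_h:u_h\in\mathcal S_{h,p+1}\}$ with $(\mathcal A_hu_h^* )_j=\lambda^*|u_j^*|^{p-1}u_j^*$. $\mathcal T_{u_h^*,h}=\{\xi_h:\langle|u_h^*|^{p-1}u_h^*,\xi_h\rangle_h=0\}$. (NDh): there is $c>0$ with $\langle\mathcal A_h\xi_h,\xi_h\rangle_h-p\lambda^*\langle|u_h^*|^{p-1}\xi_h,\xi_h\rangle_h\ge c\|\xi_h\|_{1,h}^2$ for all $\xi_h\in\mathcal T_{u_h^*,h}$. $U_{h,\delta}(u_h^* )=\{u_h:\|u_h-u_h^*\|_{1,h}\le\delta\}$. Fully discrete GFALM: for $j\in\Gamma_h$, $\frac1\tau(\widetilde u_j^{n+1}-u_j^n)=-\widetilde\mu_j^{n+1}$, $\widetilde\mu_j^{n+1}=-\frac12(\mathbf D_{xx}\widetilde u_h^{n+1})_j+(V_j+\omega-\widetilde\lambda_h(u_h^n)|u_j^n|^{p-1})u_j^n+\alpha(\widetilde u_j^{n+1}-u_j^n)$,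 and $u_j^{n+1}=\widetilde u_j^{n+1}/\|\widetilde u_h^{n+1}\|_{h,p+1}$. *)

(* Defs.v *)
From Stdlib Require Import Reals.
From Coquelicot Require Import Coquelicot.
Open Scope R_scope.

(* Grid functions are modelled as nat -> R; only indices j < M are used. *)

Fixpoint rsum (n : nat) (f : nat -> R) : R :=
  match n with O => 0 | S k => rsum k f + f k end.

Fixpoint rmax0 (n : nat) (f : nat -> R) : R :=
  match n with O => 0 | S k => Rmax (rmax0 k f) (f k) end.

(* x^y for x >= 0, y > 0, with 0^y = 0 *)
Definition rpow (x y : R) : R := if Rle_dec x 0 then 0 else Rpower x y.
Definition apow (x q : R) : R := rpow (Rabs x) q.

Section Grid.
Variables (x0 L : R) (M : nat).

Definition hh : R := L / INR M.
Definition sigma : R := 2 * PI / L.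
Definition xg (j : nat) : R := x0 + INR j * hh.

(* a_l for l = k - M/2, k = 0..M *)
Definition acoef (k : nat) : R := if (Nat.eqb k 0 || Nat.eqb k M)%bool then 2 else 1.

(* phi_j(x) = 1/M sum_{l=-M/2}^{M/2} 1/a_l e^{i l sigma (x - x_j)};
   since the coefficients are symmetric in l this equals its real part,
   written with cos. *)
Definition phi (j : nat) (x : R) : R :=
  / INR M * rsum (S M) (fun k =>
     / acoef k * cos ((INR k - INR (Nat.div M 2)) * sigma * (x - xg j))).

Definition Dxx (j l : nat) : R := Derive_n (phi l) 2 (xg j).
Definition Dxxu (u : nat -> R) (j : nat) : R := rsum M (fun l => Dxx j l * u l).

Definition ip (u v : nat -> R) : R := hh * rsum M (fun j => u j * v j).
Definition nrm_h2 (u : nat -> R) : R := ip u u.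
Definition semi1 (u : nat -> R) : R := ip (fun j => - Dxxu u j) u.
Definition nrm1sq (u : nat -> R) : R := nrm_h2 u + semi1 u.
Definition nrm1 (u : nat -> R) : R := sqrt (nrm1sq u).
Definition nrmq (q : R) (u : nat -> R) : R :=
  rpow (hh * rsum M (fun j => apow (u j) q)) (/ q).

Variables (V : R -> R) (omega p : R).

Definition Qh (u : nat -> R) : R :=
  / 2 * semi1 u + hh * rsum M (fun j => V (xg j) * (u j) ^ 2) + omega * nrm_h2 u.
Definition Ah (u : nat -> R) (j : nat) : R :=
  - / 2 * Dxxu u j + (V (xg j) + omega) * u j.
Definition lamt (u : nat -> R) : R := Qh u / rpow (nrmq (p + 1) u) (p + 1).

Definition lam0_set (e : R) : Prop :=
  exists u : nat -> R, sqrt (nrm_h2 u) = 1 /\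
    e = / 2 * semi1 u + hh * rsum M (fun j => V (xg j) * (u j) ^ 2).
Definition lam0' : Rbar := Glb_Rbar lam0_set.

Definition ground_state (us : nat -> R) : Prop :=
  nrmq (p + 1) us = 1 /\
  forall v : nat -> R, nrmq (p + 1) v = 1 -> Qh us <= Qh v.

Definition NDh (us : nat -> R) (lams : R) : Prop :=
  exists c : R, 0 < c /\
    forall xi : nat -> R,
      ip (fun j => apow (us j) (p - 1) * us j) xi = 0 ->
      ip (Ah xi) xi - p * lams * ip (fun j => apow (us j) (p - 1) * xi j) xi
        >= c * nrm1sq xi.

Definition GFALM (alpha tau : R) (u ut : nat -> nat -> R) : Prop :=
  forall n j, (j < M)%nat ->
    / tau * (ut (S n) j - u n j) =
      - ( - / 2 * Dxxu (ut (S n)) j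
          + (V (xg j) + omega - lamt (u n) * apow (u n j) (p - 1)) * u n j
          + alpha * (ut (S n) j - u n j))
    /\ u (S n) j = ut (S n) j / nrmq (p + 1) (ut (S n)).

End Grid.

(* Main.v *)
Require Import Defs.
From Stdlib Require Import Reals Lra Lia Psatz.
From Coquelicot Require Import Coquelicot.
Open Scope R_scope.

(** Write A = -1/2 Dxx + V + omega, f(u) = |u|^(p-1) u, Q(u) = <A u, u>, and g(u) = A u - Q(u) f(u) for the
    projected gradient on the unit sphere of l^(p+1).  One GFALM step reads B e = - g(u), where e is the
    increment and B = 1/tau + alpha - 1/2 Dxx.  The lower bound on alpha makes B - A/2 coercive; together
    with the tangent inequality |u + e|_(p+1) >= 1 + <f(u), e> for the norm, this yields the energy decay
    Q(u^(n+1)) <= Q(u^n) - c tau/(1+tau) |g(u^n)|^2.  Near the ground state, the non-degeneracy condition and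
    second-order expansions of Q, g and of the constraint give Q(u) - Q(u_star) ~ |u - u_star|^2 and
    |g(u)| ~ |u - u_star|, so the energy gap contracts by exp(- a tau/(1+tau)) at each step.  The iterates
    cannot leave the neighbourhood: one step moves by at most a constant times |u - u_star|, and the
    decreasing energy gap controls the distance. *)

(** * Powers of the absolute value *)

(** For p < 2 the map |x|^(p-1) x is differentiable at 0 but not twice, and no sign is imposed on
    the ground state. Second-order expansions therefore carry a remainder eps |w|^2, with eps small
    against the non-degeneracy constant, instead of a cubic one. Fixing h keeps this simple: radii
    are minima over finitely many nodes and all norms are equivalent, so the argument runs in the
    discrete L2 norm and returns to the H1 norm only at the initial datum and in the final bound.
    Non-degeneracy speaks of tangent directions only. A difference w of two points of the sphere is
    tangent up to second order, so its normal part costs a term of order |w|^4 in the Hessian. The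
    rate comes from comparing |g| <= m (1/tau + 1) |e| with an energy drop of at least (1/tau + 1)
    |e|^2: the quotient (1/tau + 1)/(1/tau + 1)^2 is tau/(1+tau). The energy controls the distance
    only inside the radius of the expansions, so a decreasing gap does not by itself prevent an
    escape; the a priori bound on one step closes this loop. *)

Lemma apow_ge0 (x q : R) : 0 <= apow x q.
Proof.
  unfold apow, rpow; destruct Rle_dec; [lra|left; apply exp_pos].
Qed.

Lemma apow_0 (q : R) : apow 0 q = 0.
Proof.
  unfold apow, rpow; rewrite Rabs_R0; destruct Rle_dec; lra.
Qed.

Lemma apow_neq0 (x q : R) : x <> 0 -> apow x q = exp (q * ln (Rabs x)).
Proof.
  intros Hx; unfold apow, rpow; destruct Rle_dec as [H|H]; [|reflexivity].
  pose proof (Rabs_pos_lt x Hx); lra.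
Qed.

Lemma apow_eq0 (x q : R) : apow x q = 0 -> x = 0.
Proof.
  intros H; destruct (Req_dec x 0) as [|Hx]; [assumption|].
  rewrite apow_neq0 in H by assumption.
  pose proof (exp_pos (q * ln (Rabs x))); lra.
Qed.

Lemma apow_mult (c x q : R) : apow (c * x) q = apow c q * apow x q.
Proof.
  destruct (Req_dec c 0) as [->|Hc]; [rewrite Rmult_0_l, apow_0; ring|].
  destruct (Req_dec x 0) as [->|Hx]; [rewrite Rmult_0_r, apow_0; ring|].
  rewrite !apow_neq0 by (try apply Rmult_integral_contrapositive; auto).
  rewrite Rabs_mult, ln_mult by (apply Rabs_pos_lt; assumption).
  rewrite <- exp_plus; f_equal; ring.
Qed.

Lemma apow_sub1 (x q : R) : apow x q = apow x (q - 1) * Rabs x.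
Proof.
  destruct (Req_dec x 0) as [->|Hx]; [rewrite !apow_0; ring|].
  rewrite !apow_neq0 by assumption.
  rewrite <- (exp_ln (Rabs x)) at 3 by (apply Rabs_pos_lt; assumption).
  rewrite <- exp_plus; f_equal; ring.
Qed.

Lemma apow_succ (x p : R) : apow x (p + 1) = apow x (p - 1) * x ^ 2.
Proof.
  rewrite apow_sub1, apow_sub1, <- pow2_abs.
  replace (p + 1 - 1 - 1) with (p - 1) by ring; ring.
Qed.

(** The tangent to exp at the mean [m] lies below the graph; in the weighted average of its values
    at [a] and [b] the linear parts cancel. *)
Lemma exp_convex (a b s t : R) : 0 <= s -> 0 <= t -> s + t = 1 ->
  exp (s * a + t * b) <= s * exp a + t * exp b.
Proof.
  intros Hs Ht Hst; set (m := s * a + t * b).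
  pose proof (exp_ineq1_le (a - m)) as Ha; pose proof (exp_ineq1_le (b - m)) as Hb.
  pose proof (exp_pos m) as Hm.
  replace (exp a) with (exp m * exp (a - m)) by (rewrite <- exp_plus; f_equal; ring).
  replace (exp b) with (exp m * exp (b - m)) by (rewrite <- exp_plus; f_equal; ring).
  assert (1 <= s * exp (a - m) + t * exp (b - m)).
  { apply Rle_trans with (s * (1 + (a - m)) + t * (1 + (b - m))); [|nra].
    replace (s * (1 + (a - m)) + t * (1 + (b - m))) with ((s + t) * (1 - m) + m)
      by (unfold m; ring).
    rewrite Hst; lra. }
  nra.
Qed.

(** Young's inequality with exponents (p+1)/p and p+1, obtained from convexity of exp at the two
    logarithms; zero arguments have no logarithm and are treated apart. *)
Lemma apow_young (x y p : R) : 1 < p ->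
  apow x (p - 1) * x * y <= p / (p + 1) * apow x (p + 1) + / (p + 1) * apow y (p + 1).
Proof.
  intros Hp.
  assert (Hp1 : 0 < / (p + 1)) by (apply Rinv_0_lt_compat; lra).
  assert (Hp2 : 0 < p / (p + 1)) by (apply Rdiv_lt_0_compat; lra).
  pose proof (apow_ge0 x (p + 1)); pose proof (apow_ge0 y (p + 1)).
  destruct (Req_dec x 0) as [->|Hx]; [nra|].
  destruct (Req_dec y 0) as [->|Hy]; [nra|].
  apply Rle_trans with (apow x p * Rabs y).
  { rewrite (apow_sub1 x p), Rmult_assoc, Rmult_assoc, <- Rabs_mult.
    apply Rmult_le_compat_l; [apply apow_ge0|apply Rle_abs]. }
  rewrite !apow_neq0 by assumption.
  rewrite <- (exp_ln (Rabs y)) at 1 by (apply Rabs_pos_lt; assumption).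
  rewrite <- exp_plus.
  replace (p * ln (Rabs x) + ln (Rabs y)) with
    (p / (p + 1) * ((p + 1) * ln (Rabs x)) + / (p + 1) * ((p + 1) * ln (Rabs y)))
    by (field; lra).
  apply exp_convex; [lra|lra|field; lra].
Qed.

(** * Differentiability and Taylor remainders of the powers *)

Lemma apow_cont0 (q : R) : 0 < q -> forall eps, 0 < eps ->
  exists r, 0 < r /\ forall t, Rabs t <= r -> apow t q <= eps.
Proof.
  (* The radius is eps^(1/q). *)
  intros Hq eps He; exists (exp (/ q * ln eps)); split; [apply exp_pos|].
  intros t Ht; destruct (Req_dec t 0) as [->|H0]; [rewrite apow_0; lra|].
  rewrite apow_neq0 by assumption.
  rewrite <- (exp_ln eps) by assumption.
  assert (H : ln (Rabs t) <= / q * ln eps).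
  { rewrite <- (ln_exp (/ q * ln eps)); apply ln_le; [apply Rabs_pos_lt|]; assumption. }
  apply (Rmult_le_compat_l q) in H; [|lra].
  replace (q * (/ q * ln eps)) with (ln eps) in H by (field; lra).
  destruct H as [H| ->]; [left; apply exp_increasing; assumption|lra].
Qed.

(** Dividing by [x] supplies its sign, so one formula serves both half-lines. *)
Lemma is_derive_apow_neq0 (x q : R) : x <> 0 ->
  is_derive (fun x => apow x q) x (q * (apow x q / x)).
Proof.
  intros Hx; apply (is_derive_ext_loc (fun x => exp (q * ln (Rabs x)))).
  - exists (mkposreal _ (Rabs_pos_lt x Hx)); intros y Hy.
    rewrite apow_neq0; [reflexivity|intros ->].
    unfold ball in Hy; simpl in Hy; unfold AbsRing_ball, abs, minus, plus, opp in Hy; simpl in Hy.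
    rewrite Rplus_0_l, Rabs_Ropp in Hy; lra.
  - rewrite apow_neq0 by assumption.
    auto_derive; [repeat split; auto; apply Rabs_pos_lt; assumption|].
    destruct (Rdichotomy _ _ Hx) as [H|H].
    + rewrite sign_eq_m1, Rabs_left by assumption; field; lra.
    + rewrite sign_eq_1, Rabs_right by lra; field; lra.
Qed.

(** The difference quotient of f(x) x at 0 is f itself, so continuity of f at 0 with limit 0
    suffices. This covers the point where the logarithmic formula breaks down. *)
Lemma is_derive_mult_id_0 (f : R -> R) :
  (forall eps, 0 < eps -> exists r, 0 < r /\ forall t, Rabs t <= r -> Rabs (f t) <= eps) ->
  is_derive (fun x => f x * x) 0 0.
Proof.
  intros Hf; apply is_derive_Reals; intros eps He.
  destruct (Hf (eps / 2)) as [r [Hr H]]; [lra|].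
  exists (mkposreal r Hr); intros t Ht Htr; simpl in Htr.
  replace ((f (0 + t) * (0 + t) - f 0 * 0) / t - 0) with (f t)
    by (rewrite Rplus_0_l; field; assumption).
  specialize (H t); lra.
Qed.

Lemma is_derive_apow_sub1_mult (x p : R) : 1 < p ->
  is_derive (fun x => apow x (p - 1) * x) x (p * apow x (p - 1)).
Proof.
  intros Hp; destruct (Req_dec x 0) as [->|Hx].
  - rewrite apow_0, Rmult_0_r; apply is_derive_mult_id_0; intros eps He.
    destruct (apow_cont0 (p - 1) ltac:(lra) eps He) as [r [Hr H]].
    exists r; split; [assumption|]; intros t Ht.
    rewrite Rabs_right; [auto|apply Rle_ge, apow_ge0].
  - replace (p * apow x (p - 1)) with
      ((p - 1) * (apow x (p - 1) / x) * x + apow x (p - 1) * 1) by (field; assumption).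
    apply (is_derive_mult (fun x => apow x (p - 1)) (fun x => x)).
    + apply is_derive_apow_neq0; assumption.
    + apply is_derive_Reals, derivable_pt_lim_id.
    + intros; apply Rmult_comm.
Qed.

Lemma is_derive_apow_succ (x p : R) : 1 < p ->
  is_derive (fun x => apow x (p + 1)) x ((p + 1) * (apow x (p - 1) * x)).
Proof.
  intros Hp; destruct (Req_dec x 0) as [->|Hx].
  - rewrite !Rmult_0_r.
    apply (is_derive_ext (fun x => (apow x (p - 1) * x) * x)).
    { intros t; rewrite apow_succ; simpl; ring. }
    apply is_derive_mult_id_0; intros eps He.
    destruct (apow_cont0 p ltac:(lra) eps He) as [r [Hr H]].
    exists r; split; [assumption|]; intros t Ht.
    rewrite Rabs_mult, (Rabs_right (apow _ _)), <- apow_sub1; [auto|apply Rle_ge, apow_ge0].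
  - replace ((p + 1) * (apow x (p - 1) * x)) with ((p + 1) * (apow x (p + 1) / x))
      by (rewrite apow_succ; field; assumption).
    apply is_derive_apow_neq0; assumption.
Qed.

Lemma apow_taylor1 (a p eps : R) : 1 < p -> 0 < eps ->
  exists r, 0 < r /\ forall t, Rabs t <= r ->
    Rabs (apow (a + t) (p - 1) * (a + t) - apow a (p - 1) * a - p * apow a (p - 1) * t)
      <= eps * Rabs t.
Proof.
  intros Hp He.
  pose proof (is_derive_apow_sub1_mult a p Hp) as H.
  apply is_derive_Reals in H; destruct (H eps He) as [[d Hd] H1]; simpl in H1.
  exists (d / 2); split; [lra|]; intros t Ht.
  destruct (Req_dec t 0) as [->|H0].
  { rewrite !Rplus_0_r, !Rmult_0_r, Rminus_0_r, Rminus_diag, Rabs_R0; lra. }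
  specialize (H1 t H0 ltac:(lra)).
  replace (_ - _ - _) with
    (((apow (a + t) (p - 1) * (a + t) - apow a (p - 1) * a) / t - p * apow a (p - 1)) * t)
    by (field; assumption).
  rewrite Rabs_mult; apply Rmult_le_compat_r; [apply Rabs_pos|lra].
Qed.

(** Up to the factor p + 1, the derivative in t of this remainder is the first-order remainder of
    |x|^(p-1) x. The mean value inequality integrates the hypothesis, and the radius is inherited
    unchanged. *)
Lemma apow_taylor2 (a p eps r : R) : 1 < p -> 0 <= eps ->
  (forall t, Rabs t <= r ->
    Rabs (apow (a + t) (p - 1) * (a + t) - apow a (p - 1) * a - p * apow a (p - 1) * t)
      <= eps * Rabs t) ->
  forall t, Rabs t <= r ->
    Rabs (apow (a + t) (p + 1) - apow a (p + 1) - (p + 1) * (apow a (p - 1) * a) * t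
          - (p + 1) * p / 2 * apow a (p - 1) * t ^ 2) <= (p + 1) * eps * t ^ 2.
Proof.
  intros Hp He H1 t Ht.
  set (G := fun t => apow (a + t) (p + 1) - (p + 1) * (apow a (p - 1) * a) * t
          - (p + 1) * p / 2 * apow a (p - 1) * t ^ 2).
  replace (_ - _ - _ - _) with (G t - G 0)
    by (unfold G; rewrite Rplus_0_r; ring).
  replace ((p + 1) * eps * t ^ 2) with (((p + 1) * eps * Rabs t) * Rabs (t - 0))
    by (rewrite Rminus_0_r, <- pow2_abs; ring).
  apply bounded_variation with
    (dh := fun t => (p + 1) * (apow (a + t) (p - 1) * (a + t) - apow a (p - 1) * a - p * apow a (p - 1) * t)).
  intros s Hs; rewrite !Rminus_0_r in Hs; split.
  - pose proof (is_derive_apow_succ (a + s) p Hp) as D.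
    assert (D1 : is_derive (fun s => apow (a + s) (p + 1)) s
              (1 * ((p + 1) * (apow (a + s) (p - 1) * (a + s))))).
    { apply (is_derive_comp (fun x => apow x (p + 1)) (fun s => a + s)); [exact D|].
      auto_derive; auto. }
    assert (D2 : is_derive (fun t => (p + 1) * (apow a (p - 1) * a) * t
          + (p + 1) * p / 2 * apow a (p - 1) * t ^ 2) s
          ((p + 1) * (apow a (p - 1) * a) + (p + 1) * p / 2 * apow a (p - 1) * (2 * s))).
    { auto_derive; [auto|ring]. }
    pose proof (is_derive_minus _ _ _ _ _ D1 D2) as D3.
    unfold minus, plus, opp in D3; simpl in D3.
    apply (is_derive_ext _ G) in D3.
    + match type of D3 with is_derive _ _ ?x => replace x with
        ((p + 1) * (apow (a + s) (p - 1) * (a + s) - apow a (p - 1) * a - p * apow a (p - 1) * s)) in D3 by field end.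
      exact D3.
    + intros x; unfold G; simpl; ring.
  - rewrite Rabs_mult, (Rabs_right (p + 1)), (Rmult_assoc (p + 1) eps) by lra.
    apply Rmult_le_compat_l; [lra|].
    apply Rle_trans with (eps * Rabs s); [apply H1; lra|].
    apply Rmult_le_compat_l; lra.
Qed.

(** * The discrete inner product and the spectral Laplacian *)

Lemma rsum_ext (n : nat) (f g : nat -> R) :
  (forall j, (j < n)%nat -> f j = g j) -> rsum n f = rsum n g.
Proof.
  induction n as [|n IH]; intros H; simpl; [reflexivity|].
  rewrite IH, H by auto; reflexivity.
Qed.

Lemma rsum_lin (n : nat) (a b : R) (f g : nat -> R) :
  rsum n (fun j => a * f j + b * g j) = a * rsum n f + b * rsum n g.
Proof. induction n as [|n IH]; simpl; [ring|rewrite IH; ring]. Qed.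

Lemma rsum_scal (n : nat) (a : R) (f : nat -> R) :
  rsum n (fun j => a * f j) = a * rsum n f.
Proof. induction n as [|n IH]; simpl; [ring|rewrite IH; ring]. Qed.

Lemma rsum_const (n : nat) (a : R) : rsum n (fun _ => a) = INR n * a.
Proof. induction n as [|n IH]; [simpl; ring|]. simpl rsum; rewrite IH, S_INR; ring. Qed.

Lemma rsum_le (n : nat) (f g : nat -> R) :
  (forall j, (j < n)%nat -> f j <= g j) -> rsum n f <= rsum n g.
Proof.
  induction n as [|n IH]; intros H; simpl; [lra|].
  apply Rplus_le_compat; auto.
Qed.

Lemma rsum_nonneg (n : nat) (f : nat -> R) :
  (forall j, (j < n)%nat -> 0 <= f j) -> 0 <= rsum n f.
Proof.
  intros H; replace 0 with (rsum n (fun _ => 0)) by (rewrite rsum_const; ring).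
  apply rsum_le; assumption.
Qed.

Lemma rsum_abs (n : nat) (f : nat -> R) : Rabs (rsum n f) <= rsum n (fun j => Rabs (f j)).
Proof.
  induction n as [|n IH]; simpl; [rewrite Rabs_R0; lra|].
  pose proof (Rabs_triang (rsum n f) (f n)); lra.
Qed.

Lemma rsum_ge_term (n : nat) (f : nat -> R) (j : nat) :
  (forall i, (i < n)%nat -> 0 <= f i) -> (j < n)%nat -> f j <= rsum n f.
Proof.
  induction n as [|n IH]; intros H Hj; simpl; [lia|].
  destruct (Nat.eq_dec j n) as [->|Hn].
  - assert (0 <= rsum n f) by (apply rsum_nonneg; auto); lra.
  - assert (f j <= rsum n f) by (apply IH; [auto|lia]).
    assert (0 <= f n) by auto; lra.
Qed.

Lemma rsum_swap (n m : nat) (f : nat -> nat -> R) :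
  rsum n (fun i => rsum m (fun j => f i j)) = rsum m (fun j => rsum n (fun i => f i j)).
Proof.
  induction n as [|n IH]; simpl.
  - induction m as [|m IHm]; simpl; lra.
  - rewrite IH; clear IH; induction m as [|m IHm]; simpl; [ring|]; lra.
Qed.

Lemma rsum_mult_r (n : nat) (f : nat -> R) (a : R) :
  rsum n (fun j => f j * a) = rsum n f * a.
Proof. induction n as [|n IH]; simpl; [ring|rewrite IH; ring]. Qed.

Lemma is_derive_rsum (n : nat) (f df : nat -> R -> R) (x : R) :
  (forall k, is_derive (f k) x (df k x)) ->
  is_derive (fun x => rsum n (fun k => f k x)) x (rsum n (fun k => df k x)).
Proof.
  intros H; induction n as [|n IH]; simpl.
  - apply is_derive_Reals, derivable_pt_lim_const.
  - apply (is_derive_plus (fun x => rsum n (fun k => f k x)) (f n)); auto.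
Qed.

(** The common radius is a minimum over finitely many nodes, hence the downward closure asked of
    [P]. *)
Lemma uniform_radius (n : nat) (P : nat -> R -> Prop) :
  (forall j r s, P j r -> s <= r -> P j s) ->
  (forall j, exists r, 0 < r /\ P j r) ->
  exists r, 0 < r /\ forall j, (j < n)%nat -> P j r.
Proof.
  intros Hmono Hex; induction n as [|n [r [Hr IH]]].
  - exists 1; split; [lra|lia].
  - destruct (Hex n) as [s [Hs Hn]].
    exists (Rmin r s); split; [apply Rmin_pos; assumption|]; intros j Hj.
    destruct (Nat.eq_dec j n) as [->|Hjn].
    + apply (Hmono n s); [assumption|apply Rmin_r].
    + apply (Hmono j r); [apply IH; lia|apply Rmin_l].
Qed.

Lemma uniform_bound (n : nat) (f : nat -> R) :
  exists b, 0 <= b /\ forall j, (j < n)%nat -> Rabs (f j) <= b.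
Proof.
  exists (rsum n (fun j => Rabs (f j))); split.
  - apply rsum_nonneg; intros; apply Rabs_pos.
  - intros j Hj; apply (rsum_ge_term n (fun j => Rabs (f j))); [|assumption].
    intros; apply Rabs_pos.
Qed.

Section Grid.
Variables (x0 L : R) (M : nat).
Hypotheses (HL : 0 < L) (HM : (0 < M)%nat).

Lemma hh_pos : 0 < hh L M.
Proof. apply Rdiv_lt_0_compat; [assumption|apply lt_0_INR; assumption]. Qed.

Lemma hh_mult : hh L M * INR M = L.
Proof. unfold hh; field; apply not_0_INR; lia. Qed.

Definition nh (u : nat -> R) : R := sqrt (nrm_h2 L M u).

Lemma ip_ext (u v u' v' : nat -> R) :
  (forall j, (j < M)%nat -> u j = u' j) -> (forall j, (j < M)%nat -> v j = v' j) ->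
  ip L M u v = ip L M u' v'.
Proof.
  intros Hu Hv; unfold ip; f_equal; apply rsum_ext; intros j Hj.
  rewrite Hu, Hv by assumption; reflexivity.
Qed.

Lemma ip_sym (u v : nat -> R) : ip L M u v = ip L M v u.
Proof. unfold ip; f_equal; apply rsum_ext; intros; ring. Qed.

Lemma ip_lin_l (a b : R) (u v w : nat -> R) :
  ip L M (fun j => a * u j + b * v j) w = a * ip L M u w + b * ip L M v w.
Proof.
  unfold ip; rewrite (rsum_ext M _ (fun j => a * (u j * w j) + b * (v j * w j))).
  - rewrite rsum_lin; ring.
  - intros; ring.
Qed.

Lemma ip_lin_r (a b : R) (u v w : nat -> R) :
  ip L M w (fun j => a * u j + b * v j) = a * ip L M w u + b * ip L M w v.
Proof. rewrite !(ip_sym w); apply ip_lin_l. Qed.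

Lemma ip_ge0 (u : nat -> R) : 0 <= ip L M u u.
Proof.
  unfold ip; pose proof hh_pos.
  apply Rmult_le_pos; [lra|]; apply rsum_nonneg; intros; nra.
Qed.

Lemma nh_ge0 (u : nat -> R) : 0 <= nh u.
Proof. apply sqrt_pos. Qed.

Lemma nh_sqr (u : nat -> R) : nh u ^ 2 = ip L M u u.
Proof. apply pow2_sqrt, ip_ge0. Qed.

Lemma nh_ext (u v : nat -> R) :
  (forall j, (j < M)%nat -> u j = v j) -> nh u = nh v.
Proof. intros H; unfold nh, nrm_h2; f_equal; apply ip_ext; assumption. Qed.

Lemma ip_cs (u v : nat -> R) : Rabs (ip L M u v) <= nh u * nh v.
Proof.
  apply Rsqr_incr_0_var; [|apply Rmult_le_pos; apply nh_ge0].
  rewrite <- Rsqr_abs; unfold Rsqr.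
  replace (nh u * nh v * (nh u * nh v)) with (nh u ^ 2 * nh v ^ 2) by ring.
  rewrite !nh_sqr.
  assert (E : forall a b, 0 <= a ^ 2 * ip L M u u + 2 * a * b * ip L M u v + b ^ 2 * ip L M v v).
  { intros a b; pose proof (ip_ge0 (fun j => a * u j + b * v j)) as H.
    rewrite ip_lin_l, !ip_lin_r, (ip_sym v u) in H; lra. }
  (* With x = <u,u>, y = <v,v>, z = <u,v>, the first two choices give y (xy - z^2) >= 0 and x (xy -
     z^2) >= 0; the third forces z = 0 when x = y = 0. *)
  pose proof (E (ip L M v v) (- ip L M u v)) as E1.
  pose proof (E (ip L M u v) (- ip L M u u)) as E2.
  pose proof (E 1 (- ip L M u v)) as E3.
  pose proof (ip_ge0 u) as Hu; pose proof (ip_ge0 v) as Hv.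
  set (x := ip L M u u) in *; set (y := ip L M v v) in *; set (z := ip L M u v) in *.
  destruct (Req_dec y 0) as [Hy|Hy].
  - rewrite Hy in *. destruct (Req_dec x 0) as [Hx|Hx].
    + rewrite Hx in *; nra.
    + assert (0 < x) by lra; nra.
  - assert (0 < y) by lra; nra.
Qed.

Lemma nh_triang (a b : R) (u v : nat -> R) :
  nh (fun j => a * u j + b * v j) <= Rabs a * nh u + Rabs b * nh v.
Proof.
  pose proof (nh_ge0 u) as Hu; pose proof (nh_ge0 v) as Hv.
  pose proof (Rabs_pos a); pose proof (Rabs_pos b).
  apply Rsqr_incr_0_var; [|nra]; rewrite !Rsqr_pow2.
  rewrite nh_sqr, ip_lin_l, !ip_lin_r, (ip_sym v u).
  assert (E : a * b * ip L M u v <= Rabs a * Rabs b * (nh u * nh v)).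
  { apply Rle_trans with (Rabs (a * b * ip L M u v)); [apply Rle_abs|].
    rewrite !Rabs_mult; apply Rmult_le_compat_l; [nra|apply ip_cs]. }
  pose proof (nh_sqr u); pose proof (nh_sqr v).
  pose proof (pow2_abs a); pose proof (pow2_abs b); nra.
Qed.

Lemma nh_le (D : R) (u v : nat -> R) : 0 <= D ->
  (forall j, (j < M)%nat -> Rabs (v j) <= D * Rabs (u j)) -> nh v <= D * nh u.
Proof.
  intros HD H; unfold nh, nrm_h2.
  rewrite <- (sqrt_pow2 D), <- sqrt_mult by (try apply ip_ge0; nra).
  apply sqrt_le_1_alt; unfold ip.
  replace (D ^ 2 * (hh L M * rsum M (fun j => u j * u j))) with
    (hh L M * (D ^ 2 * rsum M (fun j => u j * u j))) by ring.
  rewrite <- (rsum_scal M (D ^ 2)).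
  apply Rmult_le_compat_l; [left; apply hh_pos|]; apply rsum_le; intros j Hj.
  specialize (H j Hj); pose proof (Rabs_pos (v j)).
  pose proof (pow2_abs (v j)); pose proof (pow2_abs (u j)); nra.
Qed.

(** Passing from the norm to one node costs h^(-1/2), harmless for fixed h; a small norm then brings
    every node within reach of the scalar expansions. *)
Lemma nh_coord (u : nat -> R) (j : nat) : (j < M)%nat -> sqrt (hh L M) * Rabs (u j) <= nh u.
Proof.
  intros Hj; rewrite <- (sqrt_pow2 (Rabs (u j))) by apply Rabs_pos.
  pose proof hh_pos.
  rewrite <- sqrt_mult by (try apply pow2_ge_0; lra).
  apply sqrt_le_1_alt; unfold nrm_h2, ip; rewrite pow2_abs.
  apply Rmult_le_compat_l; [lra|].
  apply Rle_trans with (u j * u j); [lra|].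
  apply (rsum_ge_term M (fun j => u j * u j)); [intros; nra|assumption].
Qed.

Lemma nh_le_coord (b : R) (v : nat -> R) : 0 <= b ->
  (forall j, (j < M)%nat -> Rabs (v j) <= b) -> nh v <= sqrt L * b.
Proof.
  intros Hb H; unfold nh, nrm_h2.
  rewrite <- (sqrt_pow2 b), <- sqrt_mult by (try apply pow2_ge_0; lra).
  apply sqrt_le_1_alt; unfold ip.
  replace (L * b ^ 2) with (hh L M * (INR M * b ^ 2))
    by (rewrite <- Rmult_assoc, hh_mult; reflexivity).
  apply Rmult_le_compat_l; [left; apply hh_pos|].
  rewrite <- rsum_const; apply rsum_le; intros j Hj.
  specialize (H j Hj); pose proof (Rabs_pos (v j)); pose proof (pow2_abs (v j)); nra.
Qed.

Lemma nh_diag (d : nat -> R) :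
  exists D, 0 <= D /\ forall u, nh (fun j => d j * u j) <= D * nh u.
Proof.
  destruct (uniform_bound M d) as [D [HD H]]; exists D; split; [assumption|].
  intros u; apply nh_le; [assumption|]; intros j Hj.
  rewrite Rabs_mult; apply Rmult_le_compat_r; [apply Rabs_pos|auto].
Qed.

(** * The differentiation matrix in trigonometric form *)

Definition freq (k : nat) : R := (INR k - INR (Nat.div M 2)) * Defs.sigma L.

Lemma Dxx_eq (j l : nat) :
  Dxx x0 L M j l =
  - / INR M * rsum (S M) (fun k =>
      / acoef M k * freq k ^ 2 * cos (freq k * (xg x0 L M j - xg x0 L M l))).
Proof.
  unfold Dxx; simpl Derive_n.
  rewrite (Derive_ext _ (fun x => / INR M * rsum (S M) (fun k =>
    / acoef M k * freq k * - sin (freq k * (x - xg x0 L M l))))).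
  - apply is_derive_unique.
    replace (- / INR M * _) with (/ INR M * rsum (S M) (fun k => - (/ acoef M k * freq k ^ 2 * cos (freq k * (xg x0 L M j - xg x0 L M l))))).
    + apply (is_derive_scal (fun x => rsum (S M) (fun k =>
        / acoef M k * freq k * - sin (freq k * (x - xg x0 L M l))))).
      apply (is_derive_rsum (S M) (fun k x => / acoef M k * freq k * - sin (freq k * (x - xg x0 L M l)))
        (fun k x => - (/ acoef M k * freq k ^ 2 * cos (freq k * (x - xg x0 L M l))))).
      intros k; auto_derive; [auto|unfold Rminus; ring].
    + rewrite (rsum_ext _ _ (fun k => (-1) * (/ acoef M k * freq k ^ 2 * cos (freq k * (xg x0 L M j - xg x0 L M l)))))
        by (intros; ring).
      rewrite rsum_scal; ring.
  - intros x; apply is_derive_unique; unfold phi.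
    apply (is_derive_scal (fun x => rsum (S M) (fun k =>
        / acoef M k * cos (freq k * (x - xg x0 L M l))))).
    apply (is_derive_rsum (S M) (fun k x => / acoef M k * cos (freq k * (x - xg x0 L M l)))
        (fun k x => / acoef M k * freq k * - sin (freq k * (x - xg x0 L M l)))).
    intros k; auto_derive; [auto|unfold Rminus; ring].
Qed.

(** Up to sign, [cosT] and [sinT] are the real and imaginary parts of the discrete Fourier sum of
    [u] at wave number [freq k]. They arise because the addition formula for cos(x_j - x_l)
    separates the two nodes. *)
Definition cosT (u : nat -> R) (k : nat) : R :=
  rsum M (fun l => cos (freq k * xg x0 L M l) * u l).
Definition sinT (u : nat -> R) (k : nat) : R :=
  rsum M (fun l => sin (freq k * xg x0 L M l) * u l).

Lemma Dxxu_eq (u : nat -> R) (j : nat) :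
  Dxxu x0 L M u j =
  - / INR M * rsum (S M) (fun k => / acoef M k * freq k ^ 2 *
      (cos (freq k * xg x0 L M j) * cosT u k + sin (freq k * xg x0 L M j) * sinT u k)).
Proof.
  unfold Dxxu.
  rewrite (rsum_ext M _ (fun l => - / INR M * rsum (S M) (fun k =>
     / acoef M k * freq k ^ 2 * cos (freq k * (xg x0 L M j - xg x0 L M l)) * u l))).
  - rewrite rsum_scal, rsum_swap; f_equal; apply rsum_ext; intros k _.
    unfold cosT, sinT; rewrite <- rsum_lin, <- rsum_scal.
    apply rsum_ext; intros l _.
    rewrite Rmult_minus_distr_l, cos_minus; ring.
  - intros l _; rewrite Dxx_eq, Rmult_assoc, <- rsum_mult_r; reflexivity.
Qed.

(** In these sums the form is diagonal, with weights of one sign, so symmetry and negativity can be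
    read off; only the addition formula enters, not orthogonality of the modes. *)
Lemma ip_Dxxu (u v : nat -> R) :
  ip L M (Dxxu x0 L M u) v =
  - (hh L M * / INR M) * rsum (S M) (fun k => / acoef M k * freq k ^ 2 *
      (cosT u k * cosT v k + sinT u k * sinT v k)).
Proof.
  unfold ip.
  rewrite (rsum_ext M _ (fun j => - / INR M * rsum (S M) (fun k => / acoef M k * freq k ^ 2 *
      (cosT u k * (cos (freq k * xg x0 L M j) * v j) + sinT u k * (sin (freq k * xg x0 L M j) * v j))))).
  - rewrite rsum_scal, rsum_swap.
    rewrite Ropp_mult_distr_l_reverse, Ropp_mult_distr_r_reverse, Ropp_mult_distr_l_reverse, <- Rmult_assoc.
    f_equal; f_equal; apply rsum_ext; intros k _.
    rewrite rsum_scal, rsum_lin; reflexivity.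
  - intros j _; rewrite Dxxu_eq, Rmult_assoc, <- rsum_mult_r; f_equal.
    apply rsum_ext; intros; ring.
Qed.

Lemma Dxxu_sym (u v : nat -> R) : ip L M (Dxxu x0 L M u) v = ip L M (Dxxu x0 L M v) u.
Proof.
  rewrite !ip_Dxxu; f_equal; apply rsum_ext; intros; ring.
Qed.

Lemma Dxxu_nonpos (u : nat -> R) : ip L M (Dxxu x0 L M u) u <= 0.
Proof.
  rewrite ip_Dxxu; pose proof hh_pos.
  assert (0 < / INR M) by (apply Rinv_0_lt_compat, lt_0_INR; assumption).
  assert (0 < hh L M * / INR M) by (apply Rmult_lt_0_compat; assumption).
  match goal with |- _ * ?s <= 0 => assert (0 <= s) end; [|nra].
  apply rsum_nonneg; intros k _.
  assert (0 < / acoef M k).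
  { apply Rinv_0_lt_compat; unfold acoef; destruct (_ || _)%bool; lra. }
  apply Rmult_le_pos; [apply Rmult_le_pos; [lra|apply pow2_ge_0]|nra].
Qed.

Lemma Dxxu_lin (a b : R) (u v : nat -> R) (j : nat) :
  Dxxu x0 L M (fun j => a * u j + b * v j) j = a * Dxxu x0 L M u j + b * Dxxu x0 L M v j.
Proof.
  unfold Dxxu; rewrite <- rsum_lin; apply rsum_ext; intros; ring.
Qed.

Lemma Dxxu_ext (u v : nat -> R) (j : nat) :
  (forall j, (j < M)%nat -> u j = v j) -> Dxxu x0 L M u j = Dxxu x0 L M v j.
Proof. intros H; unfold Dxxu; apply rsum_ext; intros l Hl; rewrite H by assumption; reflexivity. Qed.

(** A crude inverse inequality: absolute row sums bound each entry of the image, and the coordinate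
    bounds convert back to the norm. The constant depends on h. *)
Lemma Dxxu_bounded : exists k, 0 <= k /\ forall u, nh (Dxxu x0 L M u) <= k * nh u.
Proof.
  set (row := fun j => rsum M (fun l => Rabs (Dxx x0 L M j l))).
  destruct (uniform_bound M row) as [b [Hb Hrow]].
  pose proof hh_pos; assert (Hs : 0 < sqrt (hh L M)) by (apply sqrt_lt_R0; assumption).
  exists (sqrt L * (b * / sqrt (hh L M))).
  assert (0 < / sqrt (hh L M)) by (apply Rinv_0_lt_compat; assumption).
  split; [apply Rmult_le_pos; [apply sqrt_pos|nra]|].
  intros u; rewrite Rmult_assoc; apply nh_le_coord.
  { pose proof (nh_ge0 u); apply Rmult_le_pos; nra. }
  intros j Hj; unfold Dxxu.
  eapply Rle_trans; [apply rsum_abs|].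
  apply Rle_trans with (rsum M (fun l => Rabs (Dxx x0 L M j l) * (/ sqrt (hh L M) * nh u))).
  - apply rsum_le; intros l Hl; rewrite Rabs_mult.
    apply Rmult_le_compat_l; [apply Rabs_pos|].
    pose proof (nh_coord u l Hl).
    apply Rmult_le_reg_l with (sqrt (hh L M)); [assumption|].
    rewrite <- Rmult_assoc, Rinv_r by lra; lra.
  - rewrite rsum_mult_r, Rmult_assoc; apply Rmult_le_compat_r.
    + pose proof (nh_ge0 u); nra.
    + eapply Rle_trans; [apply Rle_abs|apply (Hrow j Hj)].
Qed.

End Grid.

(** * Energy and constraint *)

Section Energy.
Variables (x0 L : R) (M : nat) (V : R -> R) (omega p : R).
Hypotheses (HL : 0 < L) (HM : (0 < M)%nat) (Hp : 1 < p).

(** The (p+1)-st power of the constraint norm: the same unit sphere, but a sum over nodes that can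
    be expanded termwise. *)
Definition mass (u : nat -> R) : R := hh L M * rsum M (fun j => apow (u j) (p + 1)).
Definition pow_grad (u : nat -> R) (j : nat) : R := apow (u j) (p - 1) * u j.
(** The multiplier is Q(u) instead of the quotient [lamt]; the two agree on the unit sphere. *)
Definition residual (u : nat -> R) (j : nat) : R :=
  Ah x0 L M V omega u j - Qh x0 L M V omega u * pow_grad u j.

Lemma Ah_lin (a b : R) (u v : nat -> R) (j : nat) :
  Ah x0 L M V omega (fun j => a * u j + b * v j) j =
  a * Ah x0 L M V omega u j + b * Ah x0 L M V omega v j.
Proof. unfold Ah; rewrite Dxxu_lin; ring. Qed.

Lemma Ah_ext (u v : nat -> R) (j : nat) : (j < M)%nat ->
  (forall j, (j < M)%nat -> u j = v j) -> Ah x0 L M V omega u j = Ah x0 L M V omega v j.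
Proof. intros Hj H; unfold Ah; rewrite (Dxxu_ext x0 L M u v j H), H by assumption; reflexivity. Qed.

Lemma ip_Ah (u v : nat -> R) :
  ip L M (Ah x0 L M V omega u) v =
  - / 2 * ip L M (Dxxu x0 L M u) v + ip L M (fun j => (V (xg x0 L M j) + omega) * u j) v.
Proof.
  transitivity (ip L M (fun j => - / 2 * Dxxu x0 L M u j + 1 * ((V (xg x0 L M j) + omega) * u j)) v).
  - apply ip_ext; intros; [unfold Ah; ring|reflexivity].
  - rewrite (ip_lin_l L M (- / 2) 1 (Dxxu x0 L M u) (fun j => (V (xg x0 L M j) + omega) * u j)); ring.
Qed.

Lemma Ah_sym (u v : nat -> R) :
  ip L M (Ah x0 L M V omega u) v = ip L M (Ah x0 L M V omega v) u.
Proof.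
  rewrite !ip_Ah, Dxxu_sym; f_equal; unfold ip; f_equal; apply rsum_ext; intros; ring.
Qed.

Lemma Qh_eq (u : nat -> R) : Qh x0 L M V omega u = ip L M (Ah x0 L M V omega u) u.
Proof.
  rewrite ip_Ah; unfold Qh, semi1, nrm_h2.
  rewrite (ip_ext L M (fun j => - Dxxu x0 L M u j) u (fun j => (-1) * Dxxu x0 L M u j + 0 * u j) u)
    by (intros; ring).
  rewrite ip_lin_l; unfold ip.
  rewrite (rsum_ext M (fun j => (V (xg x0 L M j) + omega) * u j * u j)
    (fun j => 1 * (V (xg x0 L M j) * u j ^ 2) + omega * (u j * u j))) by (intros; ring).
  rewrite rsum_lin; ring.
Qed.

Lemma Qh_ext (u v : nat -> R) :
  (forall j, (j < M)%nat -> u j = v j) -> Qh x0 L M V omega u = Qh x0 L M V omega v.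
Proof.
  intros H; rewrite !Qh_eq; apply ip_ext; [intros; apply Ah_ext|]; assumption.
Qed.

Lemma Qh_expand (a b : R) (u v : nat -> R) :
  Qh x0 L M V omega (fun j => a * u j + b * v j) =
  a ^ 2 * Qh x0 L M V omega u + 2 * a * b * ip L M (Ah x0 L M V omega u) v
    + b ^ 2 * Qh x0 L M V omega v.
Proof.
  rewrite !Qh_eq.
  rewrite (ip_ext L M _ (fun j => a * u j + b * v j)
    (fun j => a * Ah x0 L M V omega u j + b * Ah x0 L M V omega v j) (fun j => a * u j + b * v j))
    by (intros; try apply Ah_lin; reflexivity).
  rewrite ip_lin_l, !ip_lin_r, (Ah_sym v u); ring.
Qed.

Lemma Qh_scal (c : R) (u : nat -> R) :
  Qh x0 L M V omega (fun j => c * u j) = c ^ 2 * Qh x0 L M V omega u.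
Proof.
  rewrite (Qh_ext _ (fun j => c * u j + 0 * u j)) by (intros; ring).
  rewrite Qh_expand; ring.
Qed.

Lemma Ah_bounded : exists k, 0 <= k /\
  forall u, nh L M (Ah x0 L M V omega u) <= k * nh L M u.
Proof.
  destruct (Dxxu_bounded x0 L M HL HM) as [k [Hk HD]].
  destruct (nh_diag L M HL HM (fun j => V (xg x0 L M j) + omega)) as [d [Hd Hdiag]].
  exists (/ 2 * k + d); split; [lra|]; intros u.
  rewrite (nh_ext L M _ (fun j => - / 2 * Dxxu x0 L M u j + 1 * ((V (xg x0 L M j) + omega) * u j)))
    by (intros; unfold Ah; ring).
  eapply Rle_trans; [apply (nh_triang L M HL HM)|].
  rewrite Rabs_Ropp, (Rabs_right (/ 2)), Rabs_R1 by lra.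
  specialize (HD u); specialize (Hdiag u); lra.
Qed.

Lemma nh_eq0 (u : nat -> R) : nh L M u = 0 -> forall j, (j < M)%nat -> u j = 0.
Proof.
  intros H j Hj; pose proof (nh_coord L M HL HM u j Hj) as Hc; rewrite H in Hc.
  pose proof (Rabs_pos (u j)).
  pose proof (sqrt_lt_R0 _ (hh_pos L M HL HM)).
  destruct (Req_dec (u j) 0) as [|Hn]; [assumption|].
  pose proof (Rabs_pos_lt _ Hn); nra.
Qed.

(** The constant is lam0' + omega, positive by (A2'); homogeneity carries the bound from the unit
    sphere to every grid function. *)
Lemma Qh_coercive : Rbar_lt (Finite (- omega)) (lam0' x0 L M V) ->
  exists k, 0 < k /\ forall u, k * nh L M u ^ 2 <= Qh x0 L M V omega u.
Proof.
  intros Hlt.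
  assert (Hinf : exists k, 0 < k /\ forall e, lam0_set x0 L M V e -> k - omega <= e).
  { pose proof (Glb_Rbar_correct (lam0_set x0 L M V)) as [Hlb _].
    unfold lam0' in Hlt; destruct (Glb_Rbar (lam0_set x0 L M V)) as [g| |]; simpl in Hlt.
    - exists (g + omega); split; [lra|]; intros e He; specialize (Hlb e He); simpl in Hlb; lra.
    (* An infimum equal to plus infinity admits no element [e], so any positive constant will do. *)
    - exists 1; split; [lra|]; intros e He; destruct (Hlb e He).
    - contradiction. }
  destruct Hinf as [k [Hk Hinf]]; exists k; split; [assumption|]; intros u.
  destruct (Req_dec (nh L M u) 0) as [H0|H0].
  - rewrite H0, Qh_eq, (ip_ext L M _ u (Ah x0 L M V omega u) (fun j => 0 * u j + 0 * u j)).
    + rewrite ip_lin_r; lra.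
    + reflexivity.
    + intros j Hj; rewrite (nh_eq0 u H0 j Hj); ring.
  - pose proof (nh_ge0 L M u) as Hn.
    set (c := / nh L M u); assert (Hc : c * nh L M u = 1) by (unfold c; field; assumption).
    set (v := fun j => c * u j).
    assert (Hv : nrm_h2 L M v = 1).
    { unfold nrm_h2, v.
      rewrite (ip_ext L M _ _ (fun j => c * u j + 0 * u j) (fun j => c * u j + 0 * u j)) by (intros; ring).
      rewrite ip_lin_l, ip_lin_r, <- nh_sqr by assumption.
      transitivity ((c * nh L M u) ^ 2); [ring|rewrite Hc; ring]. }
    assert (He : k <= Qh x0 L M V omega v).
    { unfold Qh; rewrite Hv.
      enough (k - omega <= / 2 * semi1 x0 L M v + hh L M * rsum M (fun j => V (xg x0 L M j) * v j ^ 2))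
        by lra.
      apply Hinf; exists v; split; [rewrite Hv; apply sqrt_1|reflexivity]. }
    unfold v in He; rewrite Qh_scal in He.
    assert (E : Qh x0 L M V omega u = nh L M u ^ 2 * (c ^ 2 * Qh x0 L M V omega u)).
    { transitivity ((c * nh L M u) ^ 2 * Qh x0 L M V omega u); [rewrite Hc; ring|ring]. }
    rewrite E; pose proof (pow2_ge_0 (nh L M u)); nra.
Qed.

(** * The constraint, its normalisation and its support functional *)

Lemma mass_ge0 (u : nat -> R) : 0 <= mass u.
Proof.
  unfold mass; pose proof (hh_pos L M HL HM).
  apply Rmult_le_pos; [lra|]; apply rsum_nonneg; intros; apply apow_ge0.
Qed.

Lemma mass_eq0 (u : nat -> R) : mass u = 0 -> forall j, (j < M)%nat -> u j = 0.
Proof.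
  intros H j Hj; apply (apow_eq0 _ (p + 1)).
  pose proof (rsum_ge_term M (fun j => apow (u j) (p + 1)) j
    ltac:(intros; apply apow_ge0) Hj) as Hle; simpl in Hle.
  unfold mass in H; pose proof (hh_pos L M HL HM); pose proof (apow_ge0 (u j) (p + 1)).
  assert (rsum M (fun j => apow (u j) (p + 1)) = 0) by nra; lra.
Qed.

Lemma mass_scal (c : R) (u : nat -> R) : mass (fun j => c * u j) = apow c (p + 1) * mass u.
Proof.
  unfold mass; rewrite (rsum_ext M _ (fun j => apow c (p + 1) * apow (u j) (p + 1)))
    by (intros; apply apow_mult).
  rewrite rsum_scal; ring.
Qed.

Lemma mass_ext (u v : nat -> R) : (forall j, (j < M)%nat -> u j = v j) -> mass u = mass v.
Proof. intros H; unfold mass; f_equal; apply rsum_ext; intros; rewrite H; auto. Qed.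

Lemma nrmq_pos (u : nat -> R) : 0 < mass u -> 0 < nrmq L M (p + 1) u.
Proof.
  unfold mass; intros H; unfold nrmq, rpow; destruct Rle_dec; [lra|apply exp_pos].
Qed.

Lemma apow_nrmq (u : nat -> R) : 0 < mass u -> apow (nrmq L M (p + 1) u) (p + 1) = mass u.
Proof.
  intros H; pose proof (nrmq_pos u H) as Hn.
  unfold apow, rpow at 1; rewrite Rabs_right by lra; destruct Rle_dec; [lra|].
  unfold nrmq, rpow; fold (mass u); destruct Rle_dec; [lra|].
  rewrite Rpower_mult, Rinv_l, Rpower_1 by lra; reflexivity.
Qed.

Lemma nrmq_eq1 (u : nat -> R) : nrmq L M (p + 1) u = 1 <-> mass u = 1.
Proof.
  split; intros H.
  - assert (Hm : 0 < mass u).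
    { destruct (mass_ge0 u) as [|H0]; [assumption|].
      unfold nrmq, rpow in H; fold (mass u) in H; destruct Rle_dec; lra. }
    rewrite <- (apow_nrmq u Hm), H, apow_neq0, Rabs_R1, ln_1, Rmult_0_r, exp_0 by lra.
    reflexivity.
  - unfold nrmq; fold (mass u); rewrite H; unfold rpow; destruct Rle_dec; [lra|].
    unfold Rpower; rewrite ln_1, Rmult_0_r, exp_0; reflexivity.
Qed.

Lemma mass_normalize (u : nat -> R) : 0 < mass u ->
  mass (fun j => / nrmq L M (p + 1) u * u j) = 1.
Proof.
  intros H; pose proof (nrmq_pos u H) as Hn.
  rewrite mass_scal, <- (apow_nrmq u H) at 1.
  rewrite <- apow_mult, Rinv_l by lra.
  rewrite apow_neq0, Rabs_R1, ln_1, Rmult_0_r, exp_0 by lra; reflexivity.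
Qed.

Lemma lamt_eq (u : nat -> R) : mass u = 1 -> lamt x0 L M V omega p u = Qh x0 L M V omega u.
Proof.
  intros H; apply nrmq_eq1 in H; unfold lamt; rewrite H.
  unfold rpow; destruct Rle_dec; [lra|]; unfold Rpower.
  rewrite ln_1, Rmult_0_r, exp_0; field.
Qed.

Lemma ip_pow_grad_self (u : nat -> R) : ip L M (pow_grad u) u = mass u.
Proof.
  unfold ip, mass; f_equal; apply rsum_ext; intros; unfold pow_grad; rewrite apow_succ; ring.
Qed.

Lemma ip_pow_grad_mass (u v : nat -> R) :
  ip L M (pow_grad u) v <= p / (p + 1) * mass u + / (p + 1) * mass v.
Proof.
  apply Rle_trans with (hh L M * rsum M (fun j => p / (p + 1) * apow (u j) (p + 1)
      + / (p + 1) * apow (v j) (p + 1))).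
  - unfold ip; apply Rmult_le_compat_l; [left; apply hh_pos; assumption|].
    apply rsum_le; intros; apply apow_young; assumption.
  - rewrite rsum_lin; unfold mass; right; ring.
Qed.

Lemma ip_scal_r (c : R) (u v : nat -> R) : ip L M u (fun j => c * v j) = c * ip L M u v.
Proof.
  rewrite (ip_ext L M u _ u (fun j => c * v j + 0 * v j)) by (intros; ring).
  rewrite ip_lin_r; ring.
Qed.

(** Hölder's inequality, by scaling [v] to the unit sphere in Young's inequality, whose weights add
    up to 1. Geometrically, [pow_grad p u] supports the unit ball at [u]; this is the source of the
    tangent inequality. *)
Lemma ip_pow_grad_nrmq (u v : nat -> R) : mass u = 1 -> 0 < mass v ->
  ip L M (pow_grad u) v <= nrmq L M (p + 1) v.
Proof.
  intros Hu Hv; pose proof (nrmq_pos v Hv) as Hn.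
  pose proof (ip_pow_grad_mass u (fun j => / nrmq L M (p + 1) v * v j)) as H.
  rewrite mass_normalize, Hu, ip_scal_r in H by assumption.
  replace (p / (p + 1) * 1 + / (p + 1) * 1) with 1 in H by (field; lra).
  apply (Rmult_le_compat_l (nrmq L M (p + 1) v)) in H; [|lra].
  rewrite <- Rmult_assoc, Rinv_r in H by lra; lra.
Qed.

(** Degree-two homogeneity of Q frees minimality from the constraint. Its later use is to bound a
    normalisation factor from above by an energy. *)
Lemma ground_state_bound (us v : nat -> R) : ground_state x0 L M V omega p us -> 0 < mass v ->
  Qh x0 L M V omega us * nrmq L M (p + 1) v ^ 2 <= Qh x0 L M V omega v.
Proof.
  intros [_ Hmin] Hv; pose proof (nrmq_pos v Hv) as Hn.
  specialize (Hmin (fun j => / nrmq L M (p + 1) v * v j)).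
  rewrite Qh_scal in Hmin.
  specialize (Hmin (proj2 (nrmq_eq1 _) (mass_normalize v Hv))).
  apply (Rmult_le_compat_r (nrmq L M (p + 1) v ^ 2)) in Hmin; [|apply pow2_ge_0].
  eapply Rle_trans; [exact Hmin|right; field; lra].
Qed.

Lemma ground_state_energy_pos (us : nat -> R) :
  Rbar_lt (Finite (- omega)) (lam0' x0 L M V) -> mass us = 1 -> 0 < Qh x0 L M V omega us.
Proof.
  intros Hlam Hm; destruct (Qh_coercive Hlam) as [k [Hk HQ]].
  apply Rlt_le_trans with (k * nh L M us ^ 2); [|apply HQ].
  apply Rmult_lt_0_compat; [assumption|]; apply pow_lt.
  destruct (nh_ge0 L M us) as [|H0]; [assumption|exfalso].
  assert (mass us = 0); [|lra].
  rewrite (mass_ext us (fun j => 0 * us j)).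
  - rewrite mass_scal, apow_0; ring.
  - intros j Hj; rewrite (nh_eq0 us (eq_sym H0) j Hj); ring.
Qed.

Lemma nonlinearity_taylor (us : nat -> R) (eps : R) : 0 < eps ->
  exists r, 0 < r /\ forall w, nh L M w <= r ->
    nh L M (fun j => pow_grad (fun j => us j + w j) j - pow_grad us j - p * apow (us j) (p - 1) * w j)
      <= eps * nh L M w /\
    Rabs (mass (fun j => us j + w j) - mass us - (p + 1) * ip L M (pow_grad us) w
       - (p + 1) * p / 2 * ip L M (fun j => apow (us j) (p - 1) * w j) w)
      <= (p + 1) * eps * nh L M w ^ 2.
Proof.
  intros He.
  destruct (uniform_radius M (fun j r => forall t, Rabs t <= r ->
    Rabs (apow (us j + t) (p - 1) * (us j + t) - apow (us j) (p - 1) * us j - p * apow (us j) (p - 1) * t)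
      <= eps * Rabs t)) as [r [Hr H]].
  { intros j r s H Hs t Ht; apply H; lra. }
  { intros j; apply apow_taylor1; assumption. }
  pose proof (hh_pos L M HL HM) as Hh; pose proof (sqrt_lt_R0 _ Hh) as Hs.
  (* By [nh_coord], this norm radius forces every coordinate of [w] below [r]. *)
  exists (sqrt (hh L M) * r); split; [nra|]; intros w Hw.
  assert (Hc : forall j, (j < M)%nat -> Rabs (w j) <= r).
  { intros j Hj; pose proof (nh_coord L M HL HM w j Hj).
    apply Rmult_le_reg_l with (sqrt (hh L M)); [assumption|lra]. }
  split.
  - apply (nh_le L M HL HM); [lra|]; intros j Hj; apply (H j Hj); auto.
  - match goal with |- Rabs ?x <= _ => replace x with (hh L M * rsum M (fun j =>
      apow (us j + w j) (p + 1) - apow (us j) (p + 1) - (p + 1) * (apow (us j) (p - 1) * us j) * w j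
          - (p + 1) * p / 2 * apow (us j) (p - 1) * w j ^ 2)) end.
    + rewrite Rabs_mult, (Rabs_right (hh L M)), (nh_sqr L M HL HM) by lra.
      unfold ip; rewrite <- Rmult_assoc, (Rmult_comm _ (hh L M)), (Rmult_assoc (hh L M)), <- rsum_scal.
      apply Rmult_le_compat_l; [lra|].
      eapply Rle_trans; [apply rsum_abs|]; apply rsum_le; intros j Hj.
      replace (w j * w j) with (w j ^ 2) by ring.
      apply (apow_taylor2 _ p eps r Hp); [lra|apply (H j Hj)|auto].
    + rewrite (rsum_ext M _ (fun j => 1 * (1 * apow (us j + w j) (p + 1) + (-1) * apow (us j) (p + 1))
        + (-1) * ((p + 1) * (pow_grad us j * w j) + (p + 1) * p / 2 * (apow (us j) (p - 1) * w j * w j))))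
        by (intros; unfold pow_grad; ring).
      rewrite (rsum_lin M 1 (-1)), (rsum_lin M 1 (-1)), (rsum_lin M (p + 1)).
      unfold mass, ip; ring.
Qed.

End Energy.

(** * Expansions at the ground state *)

Section Linearization.
Variables (x0 L : R) (M : nat) (V : R -> R) (omega p : R) (us : nat -> R) (lams : R).
Hypotheses (HL : 0 < L) (HM : (0 < M)%nat) (Hp : 1 < p).
Hypothesis Hmass : mass L M p us = 1.
Hypothesis Hlam : 0 < Qh x0 L M V omega us.
Hypothesis Hel : forall j, (j < M)%nat ->
  Ah x0 L M V omega us j = lams * apow (us j) (p - 1) * us j.

Definition wt (w : nat -> R) (j : nat) : R := apow (us j) (p - 1) * w j.
(** Half the second variation at [us] of the Lagrangian Q - 2 lams/(p+1) mass. *)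
Definition hess (w : nat -> R) : R :=
  ip L M (Ah x0 L M V omega w) w - p * lams * ip L M (wt w) w.

Lemma ip_Ah_us (w : nat -> R) :
  ip L M (Ah x0 L M V omega us) w = lams * ip L M (pow_grad p us) w.
Proof.
  rewrite (ip_sym L M _ w), (ip_sym L M _ w), <- ip_scal_r; apply ip_ext; [reflexivity|].
  intros j Hj; rewrite Hel by assumption; unfold pow_grad; ring.
Qed.

Lemma multiplier_eq_energy : lams = Qh x0 L M V omega us.
Proof. rewrite Qh_eq, ip_Ah_us, ip_pow_grad_self, Hmass; ring. Qed.

(* Split w = xi + t us with xi tangent: the mixed term of the Hessian vanishes because us solves the
   Euler-Lagrange equation. *)
Lemma hess_lower (c : R) : 0 < c ->
  (forall xi, ip L M (pow_grad p us) xi = 0 -> hess xi >= c * nrm1sq x0 L M xi) ->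
  exists K, 0 <= K /\ forall w,
    c / 2 * nh L M w ^ 2 - K * ip L M (pow_grad p us) w ^ 2 <= hess w.
Proof.
  intros Hc Hnd.
  set (lam := Qh x0 L M V omega us) in *.
  (* The term (p-1) lam is the Hessian's loss along [us]; the other comes from |w|^2 <= 2 |xi|^2 + 2
     t^2 |us|^2, multiplied by c/2. *)
  exists (c * nh L M us ^ 2 + (p - 1) * lam).
  split; [pose proof (pow2_ge_0 (nh L M us)); nra|]; intros w.
  set (t := ip L M (pow_grad p us) w).
  set (xi := fun j => 1 * w j + (- t) * us j).
  assert (Hxi : ip L M (pow_grad p us) xi = 0).
  { unfold xi; rewrite ip_lin_r, ip_pow_grad_self, Hmass; unfold t; ring. }
  assert (Hw : forall j, (j < M)%nat -> w j = 1 * xi j + t * us j) by (intros; unfold xi; ring).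
  assert (Hsplit : hess w = hess xi - (p - 1) * lam * t ^ 2).
  { unfold hess; rewrite <- !Qh_eq, (Qh_ext x0 L M V omega w _ Hw), Qh_expand.
    rewrite Ah_sym, ip_Ah_us, Hxi.
    rewrite (ip_ext L M (wt w) w (fun j => 1 * wt xi j + t * wt us j) (fun j => 1 * xi j + t * us j))
      by (intros; unfold wt; rewrite Hw by assumption; ring).
    rewrite ip_lin_l, !ip_lin_r.
    replace (ip L M (wt us) xi) with 0 by (rewrite <- Hxi; reflexivity).
    replace (ip L M (wt us) us) with 1 by (rewrite <- Hmass, <- ip_pow_grad_self; reflexivity).
    replace (ip L M (wt xi) us) with 0.
    2:{ rewrite <- Hxi; unfold ip; f_equal; apply rsum_ext; intros; unfold wt, pow_grad; ring. }
    rewrite multiplier_eq_energy; fold lam; ring. }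
  specialize (Hnd xi Hxi); rewrite Hsplit.
  assert (Hn : nh L M xi ^ 2 <= nrm1sq x0 L M xi).
  { unfold nrm1sq, semi1, nrm_h2; rewrite <- nh_sqr by assumption.
    rewrite (ip_ext L M (fun j => - Dxxu x0 L M xi j) xi (fun j => (-1) * Dxxu x0 L M xi j + 0 * xi j) xi)
      by (intros; ring).
    rewrite ip_lin_l; pose proof (Dxxu_nonpos x0 L M HL HM xi); lra. }
  assert (Htri : nh L M w <= nh L M xi + Rabs t * nh L M us).
  { rewrite (nh_ext L M w _ Hw).
    eapply Rle_trans; [apply (nh_triang L M HL HM)|]; rewrite Rabs_R1; lra. }
  pose proof (nh_ge0 L M w); pose proof (pow2_abs t).
  assert (Hsq : nh L M w ^ 2 <= 2 * nh L M xi ^ 2 + 2 * (t ^ 2 * nh L M us ^ 2)).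
  { apply Rle_trans with ((nh L M xi + Rabs t * nh L M us) ^ 2); [apply pow_incr; lra|].
    pose proof (pow2_ge_0 (nh L M xi - Rabs t * nh L M us)).
    replace (t ^ 2 * nh L M us ^ 2) with ((Rabs t * nh L M us) ^ 2) by (rewrite <- (pow2_abs t); ring).
    lra. }
  nra.
Qed.

(** Equality of the two masses determines the normal component t of w up to o(|w|^2). Inserted in
    the expansion of Q, it turns the first-order term into the missing part of the Hessian, so the
    energy gap is [hess w] plus o(|w|^2). Pairing the residual with w yields the same Hessian, hence
    the lower bound on its norm. *)
Lemma local_estimates (c : R) : 0 < c ->
  (forall xi, ip L M (pow_grad p us) xi = 0 -> hess xi >= c * nrm1sq x0 L M xi) ->
  exists r c1 C1 c2 C2, 0 < r /\ 0 < c1 /\ c1 <= C1 /\ 0 < c2 /\ 0 < C2 /\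
    forall u w, (forall j, u j = us j + w j) -> mass L M p u = 1 -> nh L M w <= r ->
      c1 * nh L M w ^ 2 <= Qh x0 L M V omega u - Qh x0 L M V omega us <= C1 * nh L M w ^ 2 /\
      c2 * nh L M w <= nh L M (residual x0 L M V omega p u) <= C2 * nh L M w /\
      nh L M (pow_grad p u) <= C2.
Proof.
  intros Hc Hnd.
  destruct (hess_lower c Hc Hnd) as [K [HK Hlow]].
  destruct (Ah_bounded x0 L M V omega HL HM) as [kA [HkA HA]].
  destruct (nh_diag L M HL HM (fun j => apow (us j) (p - 1))) as [D [HD Hdiag]].
  pose proof multiplier_eq_energy as Hle.
  set (lam := Qh x0 L M V omega us) in *.
  set (F := nh L M (pow_grad p us)); assert (HF : 0 <= F) by apply nh_ge0.
  (* The Hessian will be at least c/4 |w|^2. Each remainder multiplied by lam costs c/16 and two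
     such losses occur in either lower bound, leaving c/8. *)
  set (eps := Rmin 1 (c / (16 * lam))).
  assert (Heps : 0 < eps) by (apply Rmin_pos; [lra|apply Rdiv_lt_0_compat; lra]).
  assert (Heps1 : eps <= 1) by apply Rmin_l.
  assert (Heps2 : lam * eps <= c / 16).
  { apply Rle_trans with (lam * (c / (16 * lam))).
    - apply Rmult_le_compat_l; [lra|apply Rmin_r].
    - right; field; lra. }
  destruct (nonlinearity_taylor L M p HL HM Hp us eps Heps) as [r0 [Hr0 Htay]].
  set (T := p / 2 * D + 1); assert (HT : 1 <= T) by (unfold T; nra).
  set (F2 := F + (p * D + 1)); assert (HF2 : 1 <= F2) by (unfold F2; nra).
  set (C1 := kA + p * lam * D + c).
  assert (HC1 : c <= C1) by (unfold C1; assert (0 <= p * lam * D) by (apply Rmult_le_pos; nra); lra).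
  set (C2 := kA + lam * (p * D + 1) + C1 * F2 + F2).
  (* [r1] absorbs the normal part K t^2, of order |w|^4, into the Hessian; [r2] below absorbs the
     cubic term q <f(u), w> of the residual. *)
  set (r1 := c / 4 / (K * T ^ 2 + 1)).
  assert (HKT : 0 <= K * T ^ 2) by (apply Rmult_le_pos; [|apply pow2_ge_0]; assumption).
  assert (Hr1 : 0 < r1) by (unfold r1; apply Rdiv_lt_0_compat; lra).
  set (r2 := c / 16 / (C1 * F2)).
  assert (HCF : 0 < C1 * F2) by (apply Rmult_lt_0_compat; lra).
  assert (Hr2 : 0 < r2) by (unfold r2; apply Rdiv_lt_0_compat; lra).
  exists (Rmin (Rmin 1 r0) (Rmin r1 r2)), (c / 8), C1, (c / 8), C2.
  split; [repeat apply Rmin_pos; lra|].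
  split; [lra|]; split; [lra|]; split; [lra|].
  assert (HC2a : 0 <= lam * (p * D + 1)) by (apply Rmult_le_pos; nra).
  assert (HC2 : 0 < C2) by (unfold C2; lra).
  split; [assumption|].
  intros u w Huw Hu HW.
  set (W := nh L M w) in *; assert (HW0 : 0 <= W) by apply nh_ge0.
  assert (HW1 : W <= 1).
  { eapply Rle_trans; [exact HW|]; eapply Rle_trans; [apply Rmin_l|apply Rmin_l]. }
  assert (HWr0 : W <= r0).
  { eapply Rle_trans; [exact HW|]; eapply Rle_trans; [apply Rmin_l|apply Rmin_r]. }
  assert (HWr1 : K * T ^ 2 * W <= c / 4).
  { assert (W <= r1) by (eapply Rle_trans; [exact HW|]; eapply Rle_trans; [apply Rmin_r|apply Rmin_l]).
    apply Rle_trans with ((K * T ^ 2 + 1) * r1); [nra|].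
    unfold r1; right; field; lra. }
  assert (HWr2 : C1 * F2 * W <= c / 16).
  { assert (W <= r2) by (eapply Rle_trans; [exact HW|]; eapply Rle_trans; [apply Rmin_r|apply Rmin_r]).
    apply Rle_trans with (C1 * F2 * r2); [apply Rmult_le_compat_l; lra|].
    unfold r2; right; field.
    split; apply Rgt_not_eq; lra. }
  destruct (Htay w HWr0) as [Hrem Htay2]; fold W in Hrem, Htay2.
  set (rem := fun j => pow_grad p (fun j => us j + w j) j - pow_grad p us j - p * apow (us j) (p - 1) * w j) in *.
  rewrite (mass_ext L M p (fun j => us j + w j) u) in Htay2 by (intros; symmetry; apply Huw).
  rewrite Hu, Hmass in Htay2.
  change (fun j => apow (us j) (p - 1) * w j) with (wt w) in Htay2.
  set (t := ip L M (pow_grad p us) w) in *.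
  set (P := ip L M (wt w) w) in *.
  (* Both points have mass 1, so the zeroth-order terms cancel and the expansion becomes a
     constraint on t. *)
  assert (HtP : Rabs (t + p / 2 * P) <= eps * W ^ 2).
  { replace (1 - 1 - (p + 1) * t - (p + 1) * p / 2 * P) with ((p + 1) * - (t + p / 2 * P)) in Htay2 by field.
    rewrite Rabs_mult, Rabs_Ropp, Rabs_right in Htay2 by lra.
    apply Rmult_le_reg_l with (p + 1); lra. }
  assert (HP : Rabs P <= D * W ^ 2).
  { eapply Rle_trans; [apply (ip_cs L M HL HM)|].
    specialize (Hdiag w); change (fun j => apow (us j) (p - 1) * w j) with (wt w) in Hdiag.
    fold W in Hdiag |- *; nra. }
  assert (Ht : Rabs t <= T * W ^ 2).
  { replace t with ((t + p / 2 * P) + - (p / 2) * P) by ring.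
    eapply Rle_trans; [apply Rabs_triang|].
    rewrite Rabs_mult, Rabs_Ropp, (Rabs_right (p / 2)) by lra.
    unfold T; pose proof (pow2_ge_0 W); nra. }
  assert (Hgrad : forall j, pow_grad p u j = 1 * (1 * pow_grad p us j + p * wt w j) + 1 * rem j).
  { intros j; unfold rem, pow_grad, wt; rewrite Huw; ring. }
  assert (HFu : nh L M (pow_grad p u) <= F2).
  { rewrite (nh_ext L M _ _ (fun j _ => Hgrad j)).
    eapply Rle_trans; [apply (nh_triang L M HL HM 1 1)|].
    pose proof (nh_triang L M HL HM 1 p (pow_grad p us) (wt w)) as Htr.
    rewrite Rabs_R1, (Rabs_right p) in Htr by lra; rewrite Rabs_R1.
    specialize (Hdiag w); change (fun j => apow (us j) (p - 1) * w j) with (wt w) in Hdiag.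
    fold W in Hdiag; fold F in Htr; unfold F2.
    assert (p * nh L M (wt w) <= p * D) by (apply Rmult_le_compat_l; nra).
    nra. }
  assert (Hrw : Rabs (ip L M rem w) <= eps * W ^ 2).
  { eapply Rle_trans; [apply (ip_cs L M HL HM)|]; fold W; nra. }
  set (N := hess w).
  assert (HNe : ip L M (Ah x0 L M V omega w) w = N + p * lam * P).
  { unfold N, hess; rewrite Hle; fold lam P; ring. }
  assert (HN1 : c / 4 * W ^ 2 <= N).
  { specialize (Hlow w); fold W t N in Hlow.
    assert (t ^ 2 <= T ^ 2 * W ^ 4).
    { rewrite <- pow2_abs; replace (T ^ 2 * W ^ 4) with ((T * W ^ 2) ^ 2) by ring.
      apply pow_incr; split; [apply Rabs_pos|assumption]. }
    assert (K * t ^ 2 <= K * T ^ 2 * W * (W ^ 2 * W)) by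
      (replace (K * T ^ 2 * W * (W ^ 2 * W)) with (K * (T ^ 2 * W ^ 4)) by ring;
       apply Rmult_le_compat_l; assumption).
    assert (W ^ 2 * W <= W ^ 2) by (pose proof (pow2_ge_0 W); nra).
    assert (K * T ^ 2 * W * (W ^ 2 * W) <= c / 4 * W ^ 2).
    { apply Rmult_le_compat; try assumption; [nra|]. pose proof (pow2_ge_0 W); nra. }
    lra. }
  assert (HN2 : N <= (kA + p * lam * D) * W ^ 2).
  { assert (N = ip L M (Ah x0 L M V omega w) w - p * lam * P) by lra.
    pose proof (ip_cs L M HL HM (Ah x0 L M V omega w) w) as Hcs; specialize (HA w); fold W in Hcs, HA.
    apply Rabs_le_between in Hcs; apply Rabs_le_between in HP.
    assert (0 <= p * lam) by nra.
    assert (- (p * lam * P) <= p * lam * (D * W ^ 2)) by nra.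
    nra. }
  (* The energy expands as 2 lam t + <A w, w>, and <A w, w> = N + p lam P; the terms t and P occur
     exactly in the combination controlled by the constraint. *)
  assert (HQ : Qh x0 L M V omega u - lam = N + 2 * lam * (t + p / 2 * P)).
  { rewrite (Qh_ext x0 L M V omega u (fun j => 1 * us j + 1 * w j)) by (intros; rewrite Huw; ring).
    rewrite Qh_expand, ip_Ah_us, (Qh_eq x0 L M V omega w), HNe, Hle; fold lam t; field. }
  assert (HlamP : Rabs (lam * (t + p / 2 * P)) <= c / 16 * W ^ 2).
  { rewrite Rabs_mult, (Rabs_right lam) by lra.
    apply Rle_trans with (lam * (eps * W ^ 2)); [apply Rmult_le_compat_l; lra|].
    rewrite <- Rmult_assoc; apply Rmult_le_compat_r; [apply pow2_ge_0|assumption]. }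
  apply Rabs_le_between in HlamP.
  assert (HW2 : 0 <= W ^ 2) by apply pow2_ge_0.
  assert (HQ1 : c / 8 * W ^ 2 <= Qh x0 L M V omega u - lam) by lra.
  assert (HQ2 : Qh x0 L M V omega u - lam <= C1 * W ^ 2).
  { unfold C1; nra. }
  set (q := Qh x0 L M V omega u - lam) in *.
  assert (Hq0 : 0 <= q) by nra.
  split; [split; assumption|].
  (* The zeroth-order part vanishes by the Euler-Lagrange equation; the change q of the multiplier
     is already quadratic in w. *)
  assert (Hres : forall j, (j < M)%nat -> residual x0 L M V omega p u j =
    1 * (1 * Ah x0 L M V omega w j + (- lam) * (p * wt w j + 1 * rem j)) + (- q) * pow_grad p u j).
  { intros j Hj; unfold residual.
    rewrite (Ah_ext x0 L M V omega u (fun j => 1 * us j + 1 * w j) j Hj) by (intros; rewrite Huw; ring).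
    rewrite Ah_lin, Hel, Hle by assumption; fold lam.
    replace (Qh x0 L M V omega u) with (lam + q) by (unfold q; ring).
    replace (lam * apow (us j) (p - 1) * us j) with (lam * pow_grad p us j) by (unfold pow_grad; ring).
    rewrite Rmult_plus_distr_r, (Hgrad j) at 1; ring. }
  split; [|unfold C2; nra].
  split.
  - destruct HW0 as [HWp|HW0]; [|rewrite <- HW0, Rmult_0_r; apply nh_ge0].
    apply Rmult_le_reg_r with W; [assumption|].
    eapply Rle_trans; [|apply (ip_cs L M HL HM)].
    eapply Rle_trans; [|apply Rle_abs].
    rewrite (ip_ext L M _ w _ w Hres) by reflexivity.
    rewrite (ip_lin_l L M 1 (- q)), (ip_lin_l L M 1 (- lam)), (ip_lin_l L M p 1), HNe; fold P.
    pose proof (ip_cs L M HL HM (pow_grad p u) w) as Hfw; fold W in Hfw.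
    assert (Hqf : Rabs (q * ip L M (pow_grad p u) w) <= c / 16 * W ^ 2).
    { rewrite Rabs_mult, (Rabs_right q) by lra.
      apply Rle_trans with (C1 * W ^ 2 * (F2 * W)).
      - apply Rmult_le_compat; [lra|apply Rabs_pos|lra|nra].
      - replace (C1 * W ^ 2 * (F2 * W)) with (C1 * F2 * W * W ^ 2) by ring.
        apply Rmult_le_compat_r; assumption. }
    assert (Hlr : Rabs (lam * ip L M rem w) <= c / 16 * W ^ 2).
    { rewrite Rabs_mult, (Rabs_right lam) by lra.
      apply Rle_trans with (lam * (eps * W ^ 2)); [apply Rmult_le_compat_l; lra|].
      rewrite <- Rmult_assoc; apply Rmult_le_compat_r; assumption. }
    apply Rabs_le_between in Hqf; apply Rabs_le_between in Hlr.
    replace (c / 8 * W * W) with (c / 8 * W ^ 2) by ring; lra.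
  - rewrite (nh_ext L M _ _ Hres).
    eapply Rle_trans; [apply (nh_triang L M HL HM 1 (- q))|].
    pose proof (nh_triang L M HL HM 1 (- lam) (Ah x0 L M V omega w) (fun j => p * wt w j + 1 * rem j)) as Ha.
    pose proof (nh_triang L M HL HM p 1 (wt w) rem) as Hb.
    rewrite Rabs_R1, Rabs_Ropp, (Rabs_right lam) in Ha by lra.
    rewrite Rabs_R1, (Rabs_right p) in Hb by lra.
    rewrite Rabs_R1, Rabs_Ropp, (Rabs_right q) by lra.
    specialize (Hdiag w); change (fun j => apow (us j) (p - 1) * w j) with (wt w) in Hdiag.
    specialize (HA w); fold W in HA, Hdiag.
    assert (Hc1 : nh L M (fun j => p * wt w j + 1 * rem j) <= (p * D + 1) * W).
    { eapply Rle_trans; [exact Hb|].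
      assert (p * nh L M (wt w) <= p * (D * W)) by (apply Rmult_le_compat_l; lra); nra. }
    assert (Hc2 : q * nh L M (pow_grad p u) <= C1 * F2 * W).
    { apply Rle_trans with (C1 * W * F2); [|right; ring].
      apply Rmult_le_compat; [lra|apply nh_ge0| |lra].
      apply Rle_trans with (C1 * W ^ 2); [lra|]; apply Rmult_le_compat_l; nra. }
    assert (Hc3 : lam * nh L M (fun j => p * wt w j + 1 * rem j) <= lam * (p * D + 1) * W).
    { rewrite Rmult_assoc; apply Rmult_le_compat_l; lra. }
    unfold C2; nra.
Qed.

End Linearization.

(** * The iteration *)

Lemma rmax0_ge (n : nat) (f : nat -> R) (j : nat) : (j < n)%nat -> f j <= rmax0 n f.
Proof.
  induction n as [|n IH]; intros Hj; simpl; [lia|].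
  destruct (Nat.eq_dec j n) as [->|Hn]; [apply Rmax_r|].
  eapply Rle_trans; [apply IH; lia|apply Rmax_l].
Qed.

Lemma rmax0_ge0 (n : nat) (f : nat -> R) : 0 <= rmax0 n f.
Proof.
  induction n as [|n IH]; simpl; [lra|].
  eapply Rle_trans; [exact IH|apply Rmax_l].
Qed.

Section Step.
Variables (x0 L : R) (M : nat) (V : R -> R) (omega p alpha kD : R).
Hypotheses (HL : 0 < L) (HM : (0 < M)%nat) (Hp : 1 < p).
Hypothesis Halpha : alpha >= / 2 * rmax0 M (fun j => V (xg x0 L M j) + omega) + / 2.
Hypotheses (HkD : 0 <= kD) (HD : forall u, nh L M (Dxxu x0 L M u) <= kD * nh L M u).

Lemma alpha_ge_half : / 2 <= alpha.
Proof. pose proof (rmax0_ge0 M (fun j => V (xg x0 L M j) + omega)); lra. Qed.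

(** * A single step of the scheme *)

Section OneStep.
Variables (tau : R) (u ut e : nat -> R).
Hypotheses (Htau : 0 < tau) (Hmass : mass L M p u = 1).
Hypothesis (He : forall j, ut j = 1 * u j + 1 * e j).
Hypothesis (Hscheme : forall j, (j < M)%nat ->
  (/ tau + alpha) * e j - / 2 * Dxxu x0 L M ut j =
    - (V (xg x0 L M j) + omega) * u j + Qh x0 L M V omega u * pow_grad p u j).

Lemma residual_increment (j : nat) : (j < M)%nat ->
  residual x0 L M V omega p u j = - (/ tau + alpha) * e j + / 2 * Dxxu x0 L M e j.
Proof.
  intros Hj; specialize (Hscheme j Hj).
  rewrite (Dxxu_ext x0 L M ut (fun j => 1 * u j + 1 * e j)), Dxxu_lin in Hscheme by (intros; apply He).
  unfold residual, Ah; lra.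
Qed.

Lemma ip_residual_increment :
  ip L M (residual x0 L M V omega p u) e =
    - (/ tau + alpha) * nh L M e ^ 2 + / 2 * ip L M (Dxxu x0 L M e) e.
Proof.
  rewrite (ip_ext L M _ e _ e residual_increment) by reflexivity.
  rewrite (ip_lin_l L M _ _ e (Dxxu x0 L M e)), <- nh_sqr by assumption; reflexivity.
Qed.

(** Since 1/tau + alpha >= 1/2 for every tau, the step stays comparable to the residual even for
    huge tau. *)
Lemma increment_le : nh L M e <= 2 * nh L M (residual x0 L M V omega p u).
Proof.
  pose proof alpha_ge_half; pose proof (Rinv_0_lt_compat tau Htau).
  pose proof ip_residual_increment as Hip; pose proof (Dxxu_nonpos x0 L M HL HM e).
  pose proof (ip_cs L M HL HM (residual x0 L M V omega p u) e) as Hcs.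
  apply Rabs_le_between in Hcs.
  pose proof (nh_ge0 L M (residual x0 L M V omega p u)) as Hg.
  destruct (nh_ge0 L M e) as [He0|He0]; [|rewrite <- He0; lra].
  assert ((/ tau + alpha) * nh L M e ^ 2 <= nh L M (residual x0 L M V omega p u) * nh L M e) by lra.
  assert (/ 2 * nh L M e ^ 2 <= (/ tau + alpha) * nh L M e ^ 2)
    by (apply Rmult_le_compat_r; [apply pow2_ge_0|lra]).
  apply Rmult_le_reg_r with (nh L M e); [assumption|].
  simpl in *; lra.
Qed.

(** The product form isolates tau: 1/tau + alpha + kD is at most (1 + alpha + kD)(1/tau + 1). *)
Lemma residual_le_increment :
  nh L M (residual x0 L M V omega p u) <= (1 + alpha + kD) * ((1 + tau) / tau) * nh L M e.
Proof.
  pose proof alpha_ge_half; pose proof (Rinv_0_lt_compat tau Htau) as Ht.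
  rewrite (nh_ext L M _ _ residual_increment).
  eapply Rle_trans; [apply (nh_triang L M HL HM)|].
  rewrite Rabs_Ropp, !Rabs_right by lra.
  specialize (HD e); pose proof (nh_ge0 L M e).
  replace ((1 + tau) / tau) with (/ tau + 1) by (field; lra).
  apply Rle_trans with ((/ tau + alpha + kD) * nh L M e); [nra|].
  apply Rmult_le_compat_r; [assumption|nra].
Qed.

(** Twice <g, e> contributes -(2/tau + 2 alpha) |e|^2, while V + omega <= 2 alpha - 1 bounds the
    potential part of Q(e). Thus alpha cancels and 2/tau + 1 survives; the Dxx terms add up to 1/2
    <Dxx e, e> <= 0. *)
Lemma energy_increment :
  Qh x0 L M V omega ut <=
    Qh x0 L M V omega u * (1 + 2 * ip L M (pow_grad p u) e) - (2 * / tau + 1) * nh L M e ^ 2.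
Proof.
  rewrite (Qh_ext x0 L M V omega ut (fun j => 1 * u j + 1 * e j)) by (intros; apply He).
  rewrite Qh_expand, (Qh_eq x0 L M V omega e), (ip_Ah x0 L M V omega e).
  pose proof ip_residual_increment as Hip.
  rewrite (ip_ext L M _ e (fun j => 1 * Ah x0 L M V omega u j +
    (- Qh x0 L M V omega u) * pow_grad p u j) e) in Hip
    by (intros; unfold residual; ring).
  rewrite (ip_lin_l L M 1) in Hip.
  pose proof (Dxxu_nonpos x0 L M HL HM e).
  assert (Hpot : ip L M (fun j => (V (xg x0 L M j) + omega) * e j) e <= (2 * alpha - 1) * nh L M e ^ 2).
  { rewrite (nh_sqr L M HL HM); unfold ip.
    rewrite <- Rmult_assoc, (Rmult_comm _ (hh L M)), Rmult_assoc, <- (rsum_scal M (2 * alpha - 1)).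
    apply Rmult_le_compat_l; [left; apply hh_pos; assumption|].
    apply rsum_le; intros j Hj; rewrite Rmult_assoc.
    pose proof (rmax0_ge M (fun j => V (xg x0 L M j) + omega) j Hj) as Hm; simpl in Hm.
    apply Rmult_le_compat_r; [nra|lra]. }
  lra.
Qed.

Lemma normalization_bounds : 0 < 1 + ip L M (pow_grad p u) e ->
  0 < mass L M p ut /\ 1 + ip L M (pow_grad p u) e <= nrmq L M (p + 1) ut.
Proof.
  intros Hs.
  assert (E : ip L M (pow_grad p u) ut = 1 + ip L M (pow_grad p u) e).
  { rewrite (ip_ext L M _ ut (pow_grad p u) (fun j => 1 * u j + 1 * e j)) by (intros; auto).
    rewrite ip_lin_r, ip_pow_grad_self, Hmass; ring. }
  assert (Hpos : 0 < mass L M p ut).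
  { destruct (mass_ge0 L M p HL HM ut) as [|H0]; [assumption|exfalso].
    rewrite (ip_ext L M _ ut (pow_grad p u) (fun j => 0 * u j + 0 * u j)) in E; [|reflexivity|].
    - rewrite ip_lin_r in E; lra.
    - intros j Hj; rewrite (mass_eq0 L M p HL HM ut (eq_sym H0) j Hj); ring. }
  split; [assumption|]; rewrite <- E; apply ip_pow_grad_nrmq; assumption.
Qed.

(** With s = <f(u), e> one has 1 + 2s <= (1 + s)^2 <= nu^2, where squaring needs 1 + s > 0. Keeping
    nu^2 on the right prepares the division that passes to the normalised iterate. *)
Lemma energy_decay : 0 < 1 + ip L M (pow_grad p u) e -> 0 <= Qh x0 L M V omega u ->
  Qh x0 L M V omega ut <= Qh x0 L M V omega u * nrmq L M (p + 1) ut ^ 2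
    - / (1 + alpha + kD) ^ 2 * (tau / (1 + tau)) * nh L M (residual x0 L M V omega p u) ^ 2.
Proof.
  intros Hs HQ; destruct (normalization_bounds Hs) as [_ Hnu].
  pose proof energy_increment as Hen; pose proof residual_le_increment as Hres.
  pose proof alpha_ge_half.
  set (s := ip L M (pow_grad p u) e) in *; set (nu := nrmq L M (p + 1) ut) in *.
  set (m := 1 + alpha + kD) in *; set (g := nh L M (residual x0 L M V omega p u)) in *.
  assert (Hg : 0 <= g) by apply nh_ge0.
  assert (Hm : 0 < m) by (unfold m; lra).
  assert (1 + 2 * s <= nu ^ 2) by (pose proof (pow2_ge_0 s); nra).
  assert (Qh x0 L M V omega u * (1 + 2 * s) <= Qh x0 L M V omega u * nu ^ 2)
    by (apply Rmult_le_compat_l; assumption).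
  assert (Hinc : / m ^ 2 * (tau / (1 + tau)) * g ^ 2 <= (2 * / tau + 1) * nh L M e ^ 2).
  { assert (Hrho : 0 < tau / (1 + tau)) by (apply Rdiv_lt_0_compat; lra).
    assert (Hm2 : 0 < / m ^ 2) by (apply Rinv_0_lt_compat, pow_lt; assumption).
    apply Rle_trans with (/ m ^ 2 * (tau / (1 + tau)) * (m * ((1 + tau) / tau) * nh L M e) ^ 2).
    - apply Rmult_le_compat_l; [nra|]; apply pow_incr; lra.
    - replace (/ m ^ 2 * (tau / (1 + tau)) * (m * ((1 + tau) / tau) * nh L M e) ^ 2)
        with ((/ tau + 1) * nh L M e ^ 2) by (field; lra).
      apply Rmult_le_compat_r; [apply pow2_ge_0|].
      pose proof (Rinv_0_lt_compat tau Htau); lra. }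
  lra.
Qed.

End OneStep.

(** * Contraction of the energy gap near the ground state *)

Variables (us : nat -> R) (r c1 C1 c2 C2 : R).
Hypothesis Hground : ground_state x0 L M V omega p us.
Hypothesis HQs : 0 < Qh x0 L M V omega us.
Hypotheses (Hr : 0 < r) (Hc1 : 0 < c1) (HC1 : c1 <= C1) (Hc2 : 0 < c2) (HC2 : 0 < C2).
Hypothesis Hlocal :
  forall u w, (forall j, u j = us j + w j) -> mass L M p u = 1 -> nh L M w <= r ->
      c1 * nh L M w ^ 2 <= Qh x0 L M V omega u - Qh x0 L M V omega us <= C1 * nh L M w ^ 2 /\
      c2 * nh L M w <= nh L M (residual x0 L M V omega p u) <= C2 * nh L M w /\
      nh L M (pow_grad p u) <= C2.

(** A Polyak-Lojasiewicz argument: the gap is at most C1 |w|^2 <= (C1/c2^2) |g|^2, so a decrease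
    proportional to |g|^2 is proportional to the gap. The factor [B] may exceed 1; it only limits
    how far one step can travel. *)
Lemma local_contraction : exists r2 B theta, 0 < r2 /\ r2 <= r /\ 0 < B /\ 0 < theta /\
  forall tau u ut un, 0 < tau -> mass L M p u = 1 -> nh L M (fun j => u j - us j) <= r2 ->
    (forall j, (j < M)%nat ->
      (/ tau + alpha) * (ut j - u j) - / 2 * Dxxu x0 L M ut j =
        - (V (xg x0 L M j) + omega) * u j + Qh x0 L M V omega u * pow_grad p u j) ->
    (forall j, (j < M)%nat -> un j = ut j / nrmq L M (p + 1) ut) ->
    mass L M p un = 1 /\
    nh L M (fun j => un j - us j) <= B * nh L M (fun j => u j - us j) /\
    Qh x0 L M V omega un - Qh x0 L M V omega us <=
      exp (- (theta * (tau / (1 + tau)))) * (Qh x0 L M V omega u - Qh x0 L M V omega us).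
Proof.
  pose proof alpha_ge_half as Ha.
  set (Qs := Qh x0 L M V omega us) in *.
  (* [b] bounds the relative energy excess, [S] the tangential increment <f(u), e>, and [E] the
     excess nu^2 - 1, each per unit of |w|. *)
  set (b := C1 / Qs); assert (Hb : 0 < b) by (apply Rdiv_lt_0_compat; lra).
  set (S := 2 * C2 ^ 2); assert (HS : 0 < S) by (unfold S; pose proof (pow_lt C2 2 HC2); lra).
  set (E := 2 * b + 2 * S); assert (HE : 2 * S <= E) by (unfold E; lra).
  set (m := 1 + alpha + kD); assert (Hm : 0 < m) by (unfold m; lra).
  set (U := nh L M us); assert (HU : 0 <= U) by apply nh_ge0.
  (* The last radius gives E |w| <= 1/2, hence nu >= 3/4 and nu^2 <= 3/2. In the rate, 1/m^2 is from
     the energy decay, c2^2/C1 from comparing |g|^2 with the gap, and 1/4 is a lower bound for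
     nu^(-2). *)
  exists (Rmin r (Rmin 1 (/ (2 * E)))), (2 * (1 + 2 * C2 + E * U)), (c2 ^ 2 / (4 * m ^ 2 * C1)).
  assert (HE2 : 0 < / (2 * E)) by (apply Rinv_0_lt_compat; lra).
  split; [repeat apply Rmin_pos; lra|].
  split; [apply Rmin_l|].
  split; [assert (0 <= E * U) by (apply Rmult_le_pos; lra); lra|].
  split.
  { apply Rdiv_lt_0_compat; [apply pow_lt; assumption|].
    pose proof (pow_lt m 2 Hm); apply Rmult_lt_0_compat; lra. }
  intros tau u ut un Htau Hu HW Hscheme Hun.
  set (w := fun j => u j - us j) in *; set (W := nh L M w) in *.
  set (e := fun j => ut j - u j).
  assert (HW0 : 0 <= W) by apply nh_ge0.
  assert (HWr : W <= r) by (eapply Rle_trans; [exact HW|apply Rmin_l]).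
  assert (HW1 : W <= 1)
    by (eapply Rle_trans; [exact HW|]; eapply Rle_trans; [apply Rmin_r|apply Rmin_l]).
  assert (HEW : E * W <= / 2).
  { apply Rle_trans with (E * / (2 * E)); [|right; field; lra].
    apply Rmult_le_compat_l; [lra|].
    eapply Rle_trans; [exact HW|]; eapply Rle_trans; [apply Rmin_r|apply Rmin_r]. }
  destruct (Hlocal u w) as [[Hq1 Hq2] [[Hg1 Hg2] Hf]]; [intros; unfold w; ring|assumption|assumption|].
  fold W in Hq1, Hq2, Hg1, Hg2.
  assert (He : forall j, ut j = 1 * u j + 1 * e j) by (intros; unfold e; ring).
  pose proof (increment_le tau u ut e Htau He Hscheme) as Hinc.
  set (g := nh L M (residual x0 L M V omega p u)) in *.
  set (s := ip L M (pow_grad p u) e).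
  pose proof (nh_ge0 L M e) as He0.
  assert (HeW : nh L M e <= 2 * C2 * W) by lra.
  assert (Hs : Rabs s <= S * W).
  { eapply Rle_trans; [apply (ip_cs L M HL HM)|].
    apply Rle_trans with (C2 * (2 * C2 * W)); [|right; unfold S; ring].
    apply Rmult_le_compat; try apply nh_ge0; assumption. }
  assert (HSW : S * W <= / 4) by nra.
  apply Rabs_le_between in Hs.
  assert (Hs1 : 0 < 1 + s) by lra.
  assert (HQu : 0 <= Qh x0 L M V omega u) by (pose proof (pow2_ge_0 W); nra).
  destruct (normalization_bounds u ut e Hu He Hs1) as [Hmass Hnu]; fold s in Hnu.
  pose proof (energy_increment tau u ut e He Hscheme) as Hen; fold s in Hen.
  pose proof (energy_decay tau u ut e Htau Hu He Hscheme Hs1 HQu) as Hdec; fold m g in Hdec.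
  pose proof (ground_state_bound x0 L M V omega p HL HM Hp us ut Hground Hmass) as Hgs; fold Qs in Hgs.
  set (nu := nrmq L M (p + 1) ut) in *.
  assert (Hnu0 : 0 < nu) by lra.
  (* The upper bound on the norm comes from minimality, Qs nu^2 <= Q(ut), combined with the energy
     estimate of the step. *)
  assert (Hnu2 : nu ^ 2 <= 1 + E * W).
  { apply Rmult_le_reg_l with Qs; [assumption|].
    eapply Rle_trans; [exact Hgs|].
    apply Rle_trans with (Qh x0 L M V omega u * (1 + 2 * s)).
    { pose proof (Rinv_0_lt_compat tau Htau).
      assert (0 <= (2 * / tau + 1) * nh L M e ^ 2)
        by (apply Rmult_le_pos; [lra|apply pow2_ge_0]); lra. }
    assert (HQuW : Qh x0 L M V omega u <= Qs * (1 + b * W)).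
    { replace (Qs * (1 + b * W)) with (Qs + C1 * W) by (unfold b; field; lra).
      assert (C1 * W ^ 2 <= C1 * W) by (apply Rmult_le_compat_l; nra); lra. }
    apply Rle_trans with (Qs * (1 + b * W) * (1 + 2 * (S * W))).
    { apply Rmult_le_compat; lra. }
    rewrite Rmult_assoc; apply Rmult_le_compat_l; [lra|].
    assert (0 <= b * W) by (apply Rmult_le_pos; lra).
    unfold E; nra. }
  assert (Hnu3 : Rabs (1 - nu) <= E * W).
  { apply Rabs_le; split; [|nra].
    enough (nu <= 1 + E * W) by lra.
    apply Rsqr_incr_0_var; [rewrite !Rsqr_pow2; nra|nra]. }
  assert (Hun' : forall j, (j < M)%nat -> un j = / nu * ut j)
    by (intros j Hj; rewrite Hun by assumption; unfold nu, Rdiv; ring).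
  assert (Hinv : 0 < / nu <= 2).
  { split; [apply Rinv_0_lt_compat; assumption|].
    replace 2 with (/ / 2) by field; apply Rinv_le_contravar; lra. }
  split; [|split].
  - rewrite (mass_ext L M p un _ Hun'); apply mass_normalize; assumption.
  (* Writing ut = us + w + e, division by nu leaves the displacement w + e and a rescaling error
     along [us]. *)
  - rewrite (nh_ext L M _ (fun j => / nu * (1 * w j + 1 * e j) + (/ nu * (1 - nu)) * us j)).
    2:{ intros j Hj; rewrite Hun' by assumption; unfold w, e; field; lra. }
    eapply Rle_trans; [apply (nh_triang L M HL HM (/ nu) (/ nu * (1 - nu)) (fun j => 1 * w j + 1 * e j) us)|].
    pose proof (nh_triang L M HL HM 1 1 w e) as Htri; rewrite Rabs_R1 in Htri; fold W in Htri.
    rewrite Rabs_mult, (Rabs_right (/ nu)) by lra; fold U.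
    assert (Rabs (1 - nu) * U <= E * W * U) by (apply Rmult_le_compat_r; assumption).
    apply Rle_trans with (/ nu * (W + 2 * C2 * W + E * W * U)).
    + rewrite Rmult_assoc, <- Rmult_plus_distr_l; apply Rmult_le_compat_l; lra.
    + replace (2 * (1 + 2 * C2 + E * U) * W) with (2 * (W + 2 * C2 * W + E * W * U)) by ring.
      apply Rmult_le_compat_r; [|lra].
      assert (0 <= E * W * U) by (repeat apply Rmult_le_pos; lra).
      assert (0 <= 2 * C2 * W) by (repeat apply Rmult_le_pos; lra); lra.
  - rewrite (Qh_ext x0 L M V omega un _ Hun'), Qh_scal.
    set (rho := tau / (1 + tau)) in *.
    assert (Hrho : 0 < rho) by (apply Rdiv_lt_0_compat; lra).
    set (q := Qh x0 L M V omega u - Qs) in *.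
    assert (Hq0 : 0 <= q) by (pose proof (pow2_ge_0 W); nra).
    assert (Hm2 : 0 < / m ^ 2) by (apply Rinv_0_lt_compat, pow_lt; assumption).
    assert (Hg0 : c2 ^ 2 / C1 * q <= g ^ 2).
    { apply Rle_trans with ((c2 * W) ^ 2).
      - apply Rle_trans with (c2 ^ 2 / C1 * (C1 * W ^ 2)).
        + apply Rmult_le_compat_l; [|assumption].
          left; apply Rdiv_lt_0_compat; [apply pow_lt; assumption|lra].
        + right; field; lra.
      - apply pow_incr; split; [apply Rmult_le_pos; lra|assumption]. }
    apply Rle_trans with ((1 - c2 ^ 2 / (4 * m ^ 2 * C1) * rho) * q).
    2:{ apply Rmult_le_compat_r; [assumption|].
        pose proof (exp_ineq1_le (- (c2 ^ 2 / (4 * m ^ 2 * C1) * rho))); lra. }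
    assert (Hscaled : (/ nu) ^ 2 * Qh x0 L M V omega ut <=
       Qh x0 L M V omega u - (/ nu) ^ 2 * (/ m ^ 2 * rho * g ^ 2)).
    { apply Rle_trans with ((/ nu) ^ 2 * (Qh x0 L M V omega u * nu ^ 2 - / m ^ 2 * rho * g ^ 2)).
      - apply Rmult_le_compat_l; [apply pow2_ge_0|assumption].
      - right; field; lra. }
    assert (Hquart : / 4 <= (/ nu) ^ 2).
    { rewrite pow_inv; apply Rinv_le_contravar; [apply pow_lt; assumption|lra]. }
    assert (Hmg : / 4 * (/ m ^ 2 * rho * (c2 ^ 2 / C1 * q)) <= (/ nu) ^ 2 * (/ m ^ 2 * rho * g ^ 2)).
    { assert (0 < / m ^ 2 * rho) by (apply Rmult_lt_0_compat; assumption).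
      assert (0 <= c2 ^ 2 / C1 * q).
      { apply Rmult_le_pos; [|assumption].
        left; apply Rdiv_lt_0_compat; [apply pow_lt; assumption|lra]. }
      apply Rmult_le_compat; [lra|apply Rmult_le_pos; lra|assumption|].
      apply Rmult_le_compat_l; lra. }
    replace ((1 - c2 ^ 2 / (4 * m ^ 2 * C1) * rho) * q) with
      (q - / 4 * (/ m ^ 2 * rho * (c2 ^ 2 / C1 * q))) by (field; split; lra).
    unfold q in *; lra.
Qed.

End Step.

(** * From one step to all iterates *)

Lemma nrm1_bounds (x0 L : R) (M : nat) (kD : R) : 0 < L -> (0 < M)%nat ->
  (forall u, nh L M (Dxxu x0 L M u) <= kD * nh L M u) ->
  forall u, nh L M u <= nrm1 x0 L M u <= sqrt (1 + kD) * nh L M u.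
Proof.
  intros HL HM HD u.
  assert (E : nrm1sq x0 L M u = nh L M u ^ 2 - ip L M (Dxxu x0 L M u) u).
  { unfold nrm1sq, semi1, nrm_h2; rewrite nh_sqr by assumption.
    rewrite (ip_ext L M (fun j => - Dxxu x0 L M u j) u (fun j => (-1) * Dxxu x0 L M u j + 0 * u j) u)
      by (intros; ring).
    rewrite ip_lin_l; ring. }
  pose proof (nh_ge0 L M u) as Hn; pose proof (Dxxu_nonpos x0 L M HL HM u).
  unfold nrm1; split.
  - rewrite <- (sqrt_pow2 (nh L M u)) by assumption; apply sqrt_le_1_alt; lra.
  - pose proof (ip_cs L M HL HM (Dxxu x0 L M u) u) as Hcs; specialize (HD u).
    apply Rabs_le_between in Hcs.
    assert (Hle : nrm1sq x0 L M u <= (1 + kD) * nh L M u ^ 2) by (rewrite E; nra).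
    destruct (Rle_dec 0 (1 + kD)) as [Hk|Hk].
    + rewrite <- (sqrt_pow2 (nh L M u)) at 1 by assumption.
      rewrite <- sqrt_mult by (try apply pow2_ge_0; lra).
      apply sqrt_le_1_alt; assumption.
    (* A negative [1 + kD] is compatible only with norm 0, where the bound is trivial. *)
    + assert (nh L M u ^ 2 = 0) by (pose proof (pow2_ge_0 (nh L M u)); nra).
      rewrite sqrt_neg_0 by nra; pose proof (sqrt_pos (1 + kD)); nra.
Qed.

Theorem mainTheorem17
  (x0 L : R) (M : nat) (V : R -> R) (p omega alpha : R)
  (us : nat -> R) (lams : R) :
  0 < L -> (0 < M)%nat -> Nat.Even M ->
  (* (A1) *)
  1 < p -> (forall x, 0 <= V x) -> (exists B, forall x, Rabs (V x) <= B) ->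
  (* (A2') *)
  Rbar_lt (Finite (- omega)) (lam0' x0 L M V) ->
  alpha >= / 2 * rmax0 M (fun j => V (xg x0 L M j) + omega) + / 2 ->
  (* u* discrete ground state with Lagrange multiplier lambda* *)
  ground_state x0 L M V omega p us ->
  (forall j, (j < M)%nat ->
     Ah x0 L M V omega us j = lams * apow (us j) (p - 1) * us j) ->
  NDh x0 L M V omega p us lams ->
  exists delta0 : R, 0 < delta0 /\
    forall u0 : nat -> R,
      nrm1 x0 L M (fun j => u0 j - us j) <= delta0 ->
      nrmq L M (p + 1) u0 = 1 ->
      exists C a : R, 0 < C /\ 0 < a /\
        forall (tau : R) (u ut : nat -> nat -> R),
          0 < tau ->
          (forall j, (j < M)%nat -> u 0%nat j = u0 j) ->
          GFALM x0 L M V omega p alpha tau u ut ->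
          forall n : nat,
            nrm1 x0 L M (fun j => u n j - us j)
              <= C * exp (- a * INR n * tau / (1 + tau)).
Proof.
  intros HL HM _ Hp _ _ Hlam0 Halpha Hground Hel [c [Hc Hnd]].
  assert (Hms : mass L M p us = 1) by (apply nrmq_eq1; [assumption..|apply Hground]).
  pose proof (ground_state_energy_pos x0 L M V omega p HL HM us Hlam0 Hms) as HQs.
  destruct (local_estimates x0 L M V omega p us lams HL HM Hp Hms HQs Hel c Hc Hnd)
    as (r & c1 & C1 & c2 & C2 & Hr & Hc1 & HC1 & Hc2 & HC2 & Hlocal).
  destruct (Dxxu_bounded x0 L M HL HM) as [kD [HkD HD]].
  destruct (local_contraction x0 L M V omega p alpha kD HL HM Hp Halpha HkD HD us r c1 C1 c2 C2
    Hground HQs Hr Hc1 HC1 Hc2 HC2 Hlocal) as (r2 & B & theta & Hr2 & Hr2r & HB & Htheta & Hstep).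
  (* A point within [rho0] admits a contraction step, and its successor lands within [r], where
     energy and distance are still comparable. *)
  set (rho0 := Rmin r2 (r / B)).
  assert (Hrho0 : 0 < rho0) by (apply Rmin_pos; [assumption|apply Rdiv_lt_0_compat; assumption]).
  (* Starting within rho0 k makes the initial gap at most C1 (rho0 k)^2 <= c1 rho0^2, the level from
     which the lower energy bound gives back distance [rho0]. *)
  set (k := c1 / C1); assert (Hk0 : 0 < k) by (apply Rdiv_lt_0_compat; lra).
  assert (HkC : C1 * k = c1) by (unfold k; field; lra).
  assert (Hk1 : k <= 1) by nra.
  exists (rho0 * k); split; [apply Rmult_lt_0_compat; assumption|].
  intros u0 Hu0 Hm0; apply nrmq_eq1 in Hm0; [|assumption..].
  (* Neither constant depends on the datum. The rate is halved because the distance is controlled by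
     the square root of the gap. *)
  exists (sqrt (1 + kD) * rho0), (theta / 2).
  split; [apply Rmult_lt_0_compat; [apply sqrt_lt_R0; lra|assumption]|].
  split; [lra|].
  intros tau u ut Htau Hinit HG.
  set (q := fun n => Qh x0 L M V omega (u n) - Qh x0 L M V omega us).
  set (W := fun n => nh L M (fun j => u n j - us j)).
  set (x := theta * (tau / (1 + tau))).
  assert (Hx : 0 < x) by (apply Rmult_lt_0_compat; [assumption|apply Rdiv_lt_0_compat; lra]).
  assert (Hest : forall n, mass L M p (u n) = 1 -> W n <= r ->
    c1 * W n ^ 2 <= q n <= C1 * W n ^ 2).
  { intros n Hm Hw; apply (Hlocal (u n) (fun j => u n j - us j)); [intros; ring|assumption|assumption]. }
  assert (Hinv : forall n, mass L M p (u n) = 1 /\ W n <= rho0 /\ q n <= exp (- (INR n * x)) * (c1 * rho0 ^ 2)).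
  { induction n as [|n [Hm [Hw Hq]]].
    - assert (Hm : mass L M p (u 0%nat) = 1) by (rewrite (mass_ext L M p _ u0 Hinit); assumption).
      assert (Hw : W 0%nat <= rho0 * k).
      { eapply Rle_trans; [|exact Hu0]; unfold W.
        rewrite (nh_ext L M _ (fun j => u0 j - us j)) by (intros; rewrite Hinit; auto).
        apply (nrm1_bounds x0 L M kD HL HM HD). }
      assert (Hw1 : W 0%nat <= rho0) by nra.
      assert (Hwr : W 0%nat <= r).
      { eapply Rle_trans; [exact Hw1|]; eapply Rle_trans; [apply Rmin_l|assumption]. }
      split; [assumption|]; split; [assumption|].
      destruct (Hest 0%nat Hm Hwr) as [_ Hq]; eapply Rle_trans; [exact Hq|].
      simpl INR; rewrite Rmult_0_l, Ropp_0, exp_0, Rmult_1_l, <- HkC, Rmult_assoc.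
      apply Rmult_le_compat_l; [lra|].
      apply Rle_trans with ((rho0 * k) ^ 2).
      + apply pow_incr; split; [apply nh_ge0|assumption].
      + pose proof (pow_lt rho0 2 Hrho0).
        replace ((rho0 * k) ^ 2) with (k * k * rho0 ^ 2) by ring.
        apply Rmult_le_compat_r; nra.
    - destruct (Hstep tau (u n) (ut (S n)) (u (S n))) as [Hm' [Hw' Hq']]; try assumption.
      { eapply Rle_trans; [exact Hw|apply Rmin_l]. }
      { intros j Hj; destruct (HG n j Hj) as [Heq _].
        rewrite (lamt_eq x0 L M V omega p HL HM Hp (u n) Hm) in Heq; unfold pow_grad; lra. }
      { intros j Hj; apply (HG n j Hj). }
      change (W (S n) <= B * W n) in Hw'; change (q (S n) <= exp (- x) * q n) in Hq'.
      assert (Hwr : W (S n) <= r).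
      { eapply Rle_trans; [exact Hw'|]; apply Rle_trans with (B * (r / B)); [|right; field; lra].
        apply Rmult_le_compat_l; [lra|]; eapply Rle_trans; [exact Hw|apply Rmin_r]. }
      assert (Hqn : q (S n) <= exp (- (INR (S n) * x)) * (c1 * rho0 ^ 2)).
      { eapply Rle_trans; [exact Hq'|].
        replace (- (INR (S n) * x)) with (- x + - (INR n * x)) by (rewrite S_INR; ring).
        rewrite exp_plus, Rmult_assoc; apply Rmult_le_compat_l; [left; apply exp_pos|assumption]. }
      split; [assumption|]; split; [|assumption].
      (* The a priori bound B W(n) <= r was needed to reach this point; the decayed gap now improves
         the radius from [r] back to [rho0]. *)
      destruct (Hest (S n) Hm' Hwr) as [Hlow _].
      apply Rsqr_incr_0_var; [rewrite !Rsqr_pow2|lra].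
      apply Rmult_le_reg_l with c1; [assumption|].
      eapply Rle_trans; [exact Hlow|]; eapply Rle_trans; [exact Hqn|].
      rewrite <- (Rmult_1_l (c1 * rho0 ^ 2)) at 2.
      apply Rmult_le_compat_r; [apply Rmult_le_pos; [lra|apply pow2_ge_0]|].
      rewrite <- exp_0; apply Rlt_le, exp_increasing.
      assert (0 < INR (S n) * x) by (apply Rmult_lt_0_compat; [apply lt_0_INR; lia|assumption]); lra. }
  intros n; destruct (Hinv n) as [Hm [Hw Hq]].
  eapply Rle_trans; [apply (nrm1_bounds x0 L M kD HL HM HD)|]; fold (W n).
  rewrite Rmult_assoc; apply Rmult_le_compat_l; [apply sqrt_pos|].
  assert (Hwr : W n <= r).
  { eapply Rle_trans; [exact Hw|]; eapply Rle_trans; [apply Rmin_l|assumption]. }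
  destruct (Hest n Hm Hwr) as [Hlow _].
  apply Rsqr_incr_0_var; [rewrite !Rsqr_pow2|apply Rmult_le_pos; [lra|left; apply exp_pos]].
  apply Rmult_le_reg_l with c1; [assumption|].
  eapply Rle_trans; [exact Hlow|]; eapply Rle_trans; [exact Hq|].
  right; rewrite Rpow_mult_distr.
  replace (exp (- (theta / 2) * INR n * tau / (1 + tau)) ^ 2) with (exp (- (INR n * x))).
  - ring.
  - simpl pow; rewrite Rmult_1_r, <- exp_plus; f_equal; unfold x; field; lra.
Qed.
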